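(* Let $x,\nu\in\mathbb{C}$ and let $S=(S_n)_{n\geq1}$ and $T=(T_n)_{n\geq1}$ be complex sequences related by the (equivalent) relations $S=B(x,\nu)\cdot T\Leftrightarrow T=A(x,\nu)\cdot S$, with $A(x,\nu)$, $B(x,\nu)$ defined in the context. Denote by $\mathfrak{G}_S(z)=\sum_{n\ge1}S_nz^n$ and $\mathfrak{G}_T(z)=\sum_{n\geq1}T_nz^n$ the formal ordinary generating series of $S$ and $T$. Define the mapping $$\Xi(z)=\frac{z}{z-1}\left(\frac{1-z}{1-z(1-x)}\right)^{\nu}.$$ Then the relations $$\mathfrak{G}_S(z)=\left[\frac{1-\nu}{1-z}+\frac{\nu}{1-z(1-x)}\right]\mathfrak{G}_T(\Xi(z))$$ and $$\mathfrak{G}_T(\xi)=\mathfrak{G}_S(\Omega(\xi))\left[\frac{1-\nu}{1-\Omega(\xi)}+\frac{\nu}{1-(1-x)\Omega(\xi)}\right]^{-1}$$ hold as identities of formal power series, where $\Omega$ is the inverse mapping $\Xi(z)=\xi\Leftrightarrow z=\Omega(\xi)$ (near $0$, with $\Omega(0)=0$).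
   Context: $A(x,\nu)$ and $B(x,\nu)$ are the infinite lower-triangular matrices (mutually inverse) with entries, for $1\le k\le n$, $$A_{n,k}(x,\nu)=(-1)^k\binom{n}{k}F(k-n,-n\nu;-n;x),\qquad B_{n,k}(x,\nu)=(-1)^k\binom{n}{k}F(k-n,k\nu;k;x),$$ where $F(k-n,\beta;\gamma;x)=\sum_{m=0}^{n-k}\frac{(k-n)_m(\beta)_m}{(\gamma)_m\,m!}x^m$ and $(c)_m=c(c+1)\cdots(c+m-1)$, $(c)_0=1$. The power $(\cdot)^\nu$ in $\Xi$ is the principal one, so it has value $1$ at $z=0$; $\Xi$ is analytic near $0$ with $\Xi(0)=0$ and $\Xi'(0)=-1$, and is identified with its power series at $0$. *)

(* Defs.v *)
From HB Require Import structures.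
From mathcomp Require Import all_boot all_order all_algebra.
From mathcomp Require Import all_classical all_reals all_analysis.
From mathcomp Require Import complex.

Set Implicit Arguments.
Unset Strict Implicit.
Unset Printing Implicit Defensive.

Import Order.TTheory GRing.Theory Num.Theory.
Import numFieldNormedType.Exports.

Local Open Scope classical_set_scope.
Local Open Scope ring_scope.
Local Open Scope complex_scope.

(* A formal power series is its coefficient sequence.  The operations are named
   because [nat -> K] already carries pointwise sums and products. *)
Definition fps (K : Type) := nat -> K.

Section FormalPowerSeries.
Variable K : fieldType.
Implicit Types (f g : fps K) (c : K).

Definition fpsC c : fps K := fun n => if n == 0%N then c else 0.
Definition fpsX : fps K := fun n => if n == 1%N then 1 else 0.
Definition fps_add f g : fps K := fun n => f n + g n.
Definition fps_sub f g : fps K := fun n => f n - g n.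
Definition fps_mul f g : fps K := fun n => \sum_(i < n.+1) f i * g (n - i)%N.
Definition fps_exp f k : fps K := iter k (fps_mul f) (fpsC 1).

(* [fps_inv_coefs f n] lists the first n coefficients of 1/f in reverse order,
   each one solved from f * (1/f) = 1. *)
Fixpoint fps_inv_coefs f n : seq K :=
  if n is m.+1 then
    let s := fps_inv_coefs f m in
    (if m == 0%N then (f 0%N)^-1
     else - (f 0%N)^-1 * \sum_(i < m) f i.+1 * s`_i) :: s
  else [::].
(* Meaningful when f 0 != 0. *)
Definition fps_inv f : fps K := fun n => head 0 (fps_inv_coefs f n.+1).

(* f(g), meaningful when g 0 = 0: then (g ^ k) n = 0 for k > n. *)
Definition fps_comp f g : fps K := fun n => \sum_(k < n.+1) f k * fps_exp g k n.

Lemma nth_fps_inv_coefs f n i :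
  (i < n)%N -> (fps_inv_coefs f n)`_i = fps_inv f (n - i.+1)%N.
Proof.
elim: n i => // n IHn [_|i]; first by rewrite subn1.
by move=> lt_in; rewrite subSS /= IHn.
Qed.

Lemma fps_mulfV f : f 0%N != 0 -> fps_mul f (fps_inv f) =1 fpsC 1.
Proof.
have invS n : fps_inv f n.+1 =
    - (f 0%N)^-1 * \sum_(i < n.+1) f i.+1 * (fps_inv_coefs f n.+1)`_i by [].
move=> f0 [|n]; first by rewrite /fps_mul big_ord1 /fps_inv /= mulfV.
rewrite /fps_mul big_ord_recl subn0 invS mulrA mulrN mulfV // mulN1r addrC.
apply/eqP; rewrite subr_eq0; apply/eqP; apply: eq_bigr => i _.
by rewrite nth_fps_inv_coefs.
Qed.

End FormalPowerSeries.

Declare Scope fps_scope.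
Delimit Scope fps_scope with fps.
Bind Scope fps_scope with fps.
Notation "f + g" := (fps_add f g) : fps_scope.
Notation "f - g" := (fps_sub f g) : fps_scope.
Notation "f * g" := (fps_mul f g) : fps_scope.
Notation "f / g" := (fps_mul f (fps_inv g)) : fps_scope.
Notation "f ^-1" := (fps_inv f) : fps_scope.
Notation "f \o g" := (fps_comp f g) : fps_scope.

Section PrincipalPower.
Variable R : realType.
Implicit Types (z w nu : R[i]).

Definition cexp z : R[i] :=
  (expR (complex.Re z) * cos (complex.Im z)) +i* (expR (complex.Re z) * sin (complex.Im z)).

(* The principal argument, in ]-pi, pi]; a junk value at z = 0. *)
Definition cArg z : R :=
  let t := acos (complex.Re z / Normc.normc z) in if 0 <= complex.Im z then t else - t.

Definition cLog z : R[i] := ln (Normc.normc z) +i* cArg z.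

(* The principal power, for w != 0. *)
Definition cpow w nu : R[i] := cexp (nu * cLog w).

End PrincipalPower.

(* The power series a converges to f in a neighbourhood of 0, i.e., f is
   analytic at 0 and a is its power series there.
   [R[i]^o] is R[i] with the topology of its norm. *)
Definition power_series_at0 (R : realType) (a : fps R[i]) (f : R[i] -> R[i]) :=
  \forall z \near (0 : R[i]^o),
    series (fun k => a k * z ^+ k : R[i]^o) @ \oo --> (f z : R[i]^o).

Definition inverse_near0 (R : realType) (f g : R[i] -> R[i]) :=
  \forall z \near (0 : R[i]^o) & w \near (0 : R[i]^o), f z = w <-> z = g w.

Section Matrices.
Variable K : fieldType.
Implicit Types (x nu b c : K) (n k m : nat) (S : nat -> K).

Definition poch c m : K := \prod_(i < m) (c + i%:R).

(* F(-N, b; c; x) for a natural number N. *)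
Definition hypF N b c x : K :=
  \sum_(m < N.+1) poch (- N%:R) m * poch b m / (poch c m * m`!%:R) * x ^+ m.

(* Only the entries with 1 <= k <= n are used below; for k > n they vanish. *)
Definition matA x nu n k : K :=
  (-1) ^+ k * 'C(n, k)%:R * hypF (n - k) (- n%:R * nu) (- n%:R) x.
Definition matB x nu n k : K :=
  (-1) ^+ k * 'C(n, k)%:R * hypF (n - k) (k%:R * nu) k%:R x.

(* Sequences are indexed from 1: the value at 0 is ignored. *)
Definition mat_apply (M : nat -> nat -> K) S n : K :=
  \sum_(1 <= k < n.+1) M n k * S k.

Definition gen_series S : fps K := fun n => if n == 0%N then 0 else S n.

(* (1 - nu) / (1 - w) + nu / (1 - (1 - x) w) *)
Definition prefactor x nu (w : fps K) : fps K :=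
  (fpsC (1 - nu) / (fpsC 1 - w) + fpsC nu / (fpsC 1 - fpsC (1 - x) * w))%fps.

End Matrices.

Definition Xi (R : realType) (x nu z : R[i]) : R[i] :=
  z / (z - 1) * cpow ((1 - z) / (1 - z * (1 - x))) nu.

(* Main.v *)
(* Put H_{c,b}(z) = (1 - z)^(b - c) (1 - (1 - x) z)^(-b).  It is determined by
   a first-order differential equation, and expanding it in powers of
   x z / (1 - z) shows that its coefficients are (c)_N / N! F(-N, b; c; x).
   Since Xi = - z H_{1,nu}, the bracket in the theorem is z Xi' / Xi, hence the
   bracket times Xi^k is z (Xi^k)' / k, and its coefficients are the B_{n,k}.
   Likewise A_{n,k} = (-1)^n [z^(n-k)] H_{-n,-n nu}; the relation A B = 1 is
   Lagrange inversion: the coefficient of z^(-1) of a derivative vanishes.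
   The analytic functions enter only through their asymptotic expansions at 0 to
   all orders, which are unique and stable under products and composition.  The
   expansion of cLog w comes from that of cexp: if l is the expected expansion,
   then cexp (cLog w - l) = 1 + O(z^n) and cLog w - l tends to 0. *)
Require Import Defs.
From mathcomp Require Import all_boot all_order all_algebra complex.
From mathcomp Require Import all_classical all_reals all_analysis.
From mathcomp Require Import zify ring lra.

Set Implicit Arguments.
Unset Strict Implicit.
Unset Printing Implicit Defensive.

Import Order.TTheory GRing.Theory Num.Theory.
Import numFieldNormedType.Exports.

Local Open Scope ring_scope.

(** * Congruence of polynomials modulo a power of X *)

(** Every identity of series is proved modulo ['X^n], for all n, on polynomial truncations, where
    [ring], composition and divisibility apply; an invertible factor is cancelled ([eqX_cancel])
    rather than inverted. Laurent series are treated in the same way: after multiplication by a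
    power of X, a residue is an ordinary coefficient. A solution of the differential equation modulo
    ['X^n] is determined modulo ['X^n.+1], whence the truncations at [n.+1]. On the analytic side,
    [cexp] and [cLog] are built from real functions of real and imaginary parts, which are not
    polynomials in z; the errors are therefore estimated separately in these parts, and only their
    sum is expanded in z. *)

Section Congruence.
Variable K : fieldType.
Implicit Types (p q r s : {poly K}) (f g : fps K) (n : nat).

Definition eqX n p q := 'X^n %| p - q.

Definition trunc n f : {poly K} := \poly_(i < n) f i.

Lemma eqXP n p q :
  reflect (forall i, (i < n)%N -> p`_i = q`_i) (eqX n p q).
Proof.
rewrite /eqX /dvdp -Pdiv.IdomainMonic.take_poly_modp; apply: (iffP eqP) => [h i lt_in|h].
  have := congr1 (fun s : {poly K} => s`_i) h.
  by rewrite /= coef_take_poly lt_in coefB coef0 => /eqP; rewrite subr_eq0 => /eqP.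
apply/polyP => i; rewrite coef_take_poly coef0; case: ifP => // /h.
by rewrite coefB => ->; rewrite subrr.
Qed.

Lemma eqX_refl n p : eqX n p p.
Proof. by rewrite /eqX subrr dvdp0. Qed.

Lemma eqX_sym n p q : eqX n p q -> eqX n q p.
Proof. by rewrite /eqX -dvdpNr opprB. Qed.

Lemma eqX_trans n q p r : eqX n p q -> eqX n q r -> eqX n p r.
Proof. by move=> pq qr; rewrite /eqX -[p](subrK q) -addrA dvdp_add. Qed.

Lemma eqXD n p p' q q' : eqX n p p' -> eqX n q q' -> eqX n (p + q) (p' + q').
Proof.
move=> hp hq; rewrite /eqX; have -> : p + q - (p' + q') = (p - p') + (q - q').
  by ring.
exact: dvdp_add.
Qed.

Lemma eqXM n p p' q q' : eqX n p p' -> eqX n q q' -> eqX n (p * q) (p' * q').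
Proof.
move=> hp hq; rewrite /eqX.
have -> : p * q - p' * q' = (p - p') * q + p' * (q - q') by ring.
by apply: dvdp_add; [apply: dvdp_mulr|apply: dvdp_mull].
Qed.

Lemma eqXN n p p' : eqX n p p' -> eqX n (- p) (- p').
Proof. by move=> hp; rewrite -mulN1r -(mulN1r p'); apply: eqXM => //; exact: eqX_refl. Qed.

Lemma eqXB n p p' q q' : eqX n p p' -> eqX n q q' -> eqX n (p - q) (p' - q').
Proof. by move=> hp hq; apply: eqXD => //; apply: eqXN. Qed.

Lemma eqX_exp n k p p' : eqX n p p' -> eqX n (p ^+ k) (p' ^+ k).
Proof.
move=> hp; elim: k => [|k IHk]; first by rewrite !expr0 eqX_refl.
by rewrite !exprS; apply: eqXM.
Qed.

Lemma eqX_sum n m (F G : 'I_m -> {poly K}) :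
  (forall i, eqX n (F i) (G i)) -> eqX n (\sum_i F i) (\sum_i G i).
Proof.
by move=> h; apply: (big_ind2 (eqX n)) => //; [exact: eqX_refl|move=> *; exact: eqXD].
Qed.

Lemma eqX_leq m n p q : (m <= n)%N -> eqX n p q -> eqX m p q.
Proof. by move=> le_mn; apply: dvdp_trans; apply: dvdp_exp2l. Qed.

Lemma dvdXn_cancel n p q : p`_0 != 0 -> 'X^n %| p * q -> 'X^n %| q.
Proof.
move=> p0; rewrite Gauss_dvdpr // coprimep_expl //.
by rewrite coprimep_sym coprimepX /root horner_coef0.
Qed.

Lemma eqX_cancel n r p q : r`_0 != 0 -> eqX n (r * p) (r * q) -> eqX n p q.
Proof. by move=> r0; rewrite /eqX -mulrBr; apply: dvdXn_cancel. Qed.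

Lemma dvdXn_exp n p : p`_0 = 0 -> 'X^n %| p ^+ n.
Proof.
by move=> p0; rewrite dvdp_exp2r // -['X]subr0 dvdp_XsubCl /root horner_coef0 p0.
Qed.

(** If X^n divides p - q, then s^n divides (p - q) composed with s, and X divides s. *)
Lemma eqX_compl n p q s : s`_0 = 0 -> eqX n p q -> eqX n (p \Po s) (q \Po s).
Proof.
move=> s0 /(dvdp_comp_poly s); rewrite comp_polyB; apply: dvdp_trans.
by rewrite rmorphXn /= comp_polyX dvdXn_exp.
Qed.

Lemma eqX_compr n p s r : eqX n s r -> eqX n (p \Po s) (p \Po r).
Proof.
move=> h; elim/poly_ind: p => [|p c IHp]; first by rewrite !comp_poly0 eqX_refl.
by rewrite !comp_poly_MXaddC; apply: eqXD; [apply: eqXM|exact: eqX_refl].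
Qed.

Lemma coef_trunc n f i : (i < n)%N -> (trunc n f)`_i = f i.
Proof. by rewrite coef_poly => ->. Qed.

Lemma coef0_trunc n f : f 0%N = 0 -> (trunc n f)`_0 = 0.
Proof. by rewrite coef_poly => ->; case: ifP. Qed.

Lemma eqX_trunc m n f : (m <= n)%N -> eqX m (trunc n f) (trunc m f).
Proof.
by move=> le_mn; apply/eqXP => i im; rewrite !coef_trunc // (leq_trans im).
Qed.

Lemma eq_trunc n f g : f =1 g -> trunc n f = trunc n g.
Proof. by move=> fg; apply/polyP => i; rewrite !coef_poly fg. Qed.

Lemma eqfps_trunc f g : (forall n, eqX n (trunc n f) (trunc n g)) -> f =1 g.
Proof. by move=> h n; have /eqXP/(_ n (leqnn _)) := h n.+1; rewrite !coef_trunc. Qed.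

Lemma truncC n c : eqX n (trunc n (fpsC c)) c%:P.
Proof. by apply/eqXP => i lt_in; rewrite coef_trunc // coefC. Qed.

Lemma truncX n : eqX n (trunc n (fpsX K)) 'X.
Proof. by apply/eqXP => i lt_in; rewrite coef_trunc // coefX /fpsX; case: ifP. Qed.

Lemma truncD n f g : trunc n (fps_add f g) = trunc n f + trunc n g.
Proof. by apply/polyP => i; rewrite coefD !coef_poly; case: ifP; rewrite ?addr0. Qed.

Lemma truncB n f g : trunc n (fps_sub f g) = trunc n f - trunc n g.
Proof. by apply/polyP => i; rewrite coefB !coef_poly; case: ifP; rewrite ?subr0. Qed.

Lemma truncM n f g : eqX n (trunc n (fps_mul f g)) (trunc n f * trunc n g).
Proof.
apply/eqXP => i lt_in; rewrite coef_trunc // coefM; apply: eq_bigr => j _.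
by rewrite !coef_trunc // (leq_ltn_trans _ lt_in) ?leq_subr // -ltnS.
Qed.

Lemma trunc_exp n f k : eqX n (trunc n (fps_exp f k)) (trunc n f ^+ k).
Proof.
elim: k => [|k IHk]; first exact: truncC.
by rewrite exprS; apply: eqX_trans (truncM _ _ _) _; apply: eqXM => //; apply: eqX_refl.
Qed.

Lemma truncV n f :
  f 0%N != 0 -> eqX n (trunc n f * trunc n (fps_inv f)) 1.
Proof.
move=> /fps_mulfV h; apply: eqX_trans (eqX_sym (truncM _ _ _)) _.
by rewrite (eq_trunc _ h); apply: truncC.
Qed.

Lemma comp_trunc n f q :
  trunc n f \Po q = \sum_(k < n) f k *: q ^+ k.
Proof.
rewrite /trunc poly_def linear_sum /=; apply: eq_bigr => k _.
by rewrite comp_polyZ rmorphXn /= comp_polyX.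
Qed.

(** For the coefficient i, [fps_comp] stops at k = i, whereas the polynomial composition runs up to
    n - 1; the extra terms vanish because X^k divides g^k. *)
Lemma trunc_comp n f g :
  g 0%N = 0 -> eqX n (trunc n (fps_comp f g)) (trunc n f \Po trunc n g).
Proof.
move=> g0; rewrite comp_trunc; apply/eqXP => i lt_in; rewrite coef_trunc // coef_sum.
rewrite /fps_comp (big_ord_widen n (fun k => f k * fps_exp g k i)) // big_mkcond /=.
apply: eq_bigr => k _; rewrite coefZ.
have /eqXP/(_ i lt_in) <- := trunc_exp n g k; rewrite coef_trunc //.
case: ifP => // /negbT; rewrite -leqNgt => lt_ik.
suff /eqXP/(_ i lt_ik) : eqX k (trunc n (fps_exp g k)) 0.
  by rewrite coef_trunc // coef0 => ->; rewrite mulr0.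
apply: eqX_trans (eqX_leq (ltnW (ltn_ord k)) (trunc_exp n g k)) _.
by rewrite /eqX subr0 dvdXn_exp ?coef0_trunc.
Qed.

End Congruence.

(** * The series H *)

Section Pochhammer.
Variable K : numFieldType.
Implicit Types (b c x nu : K) (i k m n N : nat).

Lemma fact_neq0 n : n`!%:R != 0 :> K.
Proof. by rewrite pnatr_eq0 -lt0n fact_gt0. Qed.

Lemma pochS c m : poch c m.+1 = poch c m * (c + m%:R).
Proof. by rewrite /poch big_ord_recr. Qed.

Lemma pochSl c m : poch c m.+1 = c * poch (c + 1) m.
Proof.
rewrite /poch big_ord_recl addr0; congr (_ * _); apply: eq_bigr => i _.
by rewrite -addrA -natr1 [1 + _]addrC.
Qed.

Lemma poch_add c m n : poch c (m + n) = poch c m * poch (c + m%:R) n.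
Proof.
elim: n => [|n IHn]; first by rewrite addn0 /poch big_ord0 mulr1.
by rewrite addnS !pochS IHn natrD addrA mulrA.
Qed.

Lemma poch_natN N m :
  (m <= N)%N -> poch (- N%:R : K) m * (N - m)`!%:R = (-1) ^+ m * N`!%:R.
Proof.
elim: m => [|m IHm] lt_mN; first by rewrite /poch big_ord0 subn0.
rewrite exprS mulN1r mulNr -IHm ?(ltnW lt_mN) // pochS.
by rewrite -[in RHS]subnSK // factS natrM subnSK // natrB ?(ltnW lt_mN) //; ring.
Qed.

Lemma poch_nat k N : poch (k.+1%:R : K) N * k`!%:R = (k + N)`!%:R.
Proof.
elim: N => [|N IHN]; first by rewrite /poch big_ord0 mul1r addn0.
by rewrite pochS addnS factS natrM -IHN -natrD addSn; ring.
Qed.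

End Pochhammer.

Section Series.
Variable K : numFieldType.
Variable x : K.
Implicit Types (b c nu : K) (p q : {poly K}) (i k m n N : nat).

(* The power series of (1 - z)^(b - c) (1 - (1 - x) z)^(-b), expanded through
   1 - (1 - x) z = (1 - z) (1 + x z / (1 - z)). *)
Definition hseries c b : fps K := fun N =>
  \sum_(m < N.+1)
    poch b m / m`!%:R * (- x) ^+ m * (poch (c + m%:R) (N - m) / (N - m)`!%:R).

(** Unlike F, [hseries] divides by no (c)_m, so that it also covers c = 0. When (c)_N is nonzero,
    (c)_N = (c)_m (c + m)_(N - m) turns one into the other. *)
Lemma hseries_hypF c b N :
  poch c N != 0 -> hseries c b N = poch c N / N`!%:R * hypF N b c x.
Proof.
move=> cN0; rewrite /hypF mulr_sumr; apply: eq_bigr => m _.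
have le_mN : (m <= N)%N by rewrite -ltnS.
have dN : poch c N = poch c m * poch (c + m%:R) (N - m).
  by rewrite -poch_add subnKC.
have cm0 : poch c m != 0 by move: cN0; rewrite dN mulf_eq0 negb_or => /andP[].
have -> : poch (- N%:R) m = (-1) ^+ m * N`!%:R / (N - m)`!%:R :> K.
  by rewrite -poch_natN // mulfK ?fact_neq0.
rewrite [(- x) ^+ m]exprNn dN; move: ((-1) ^+ m) (x ^+ m) => e y; field.
by rewrite !fact_neq0 cm0.
Qed.

Lemma hseries0 c b : hseries c b 0 = 1.
Proof. by rewrite /hseries big_ord1 /poch !big_ord0 !expr0 fact0 !divr1 !mulr1. Qed.

(** Here C(n, k) = (n / k) (k)_(n - k) / (n - k)!. The factor n / k that is left over is the trace
    of the operator z d/dz acting on z^k H. *)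
Lemma matB_hseries nu n k : (0 < k <= n)%N ->
  matB x nu n k = (-1) ^+ k * (n%:R / k%:R) * hseries k%:R (k%:R * nu) (n - k)%N.
Proof.
case: k => // k /= lt_kn.
have pE : poch (k.+1%:R : K) (n - k.+1) = n.-1`!%:R / k`!%:R.
  have -> : n.-1 = (k + (n - k.+1))%N by lia.
  by rewrite -poch_nat mulfK ?fact_neq0.
rewrite hseries_hypF pE ?mulf_neq0 ?invr_eq0 ?fact_neq0 //.
have k0 : k.+1%:R != 0 :> K by rewrite pnatr_eq0.
have CE : 'C(n, k.+1)%:R =
    n%:R / k.+1%:R * (n.-1`!%:R / k`!%:R / (n - k.+1)`!%:R) :> K.
  have : 'C(n, k.+1)%:R * (k.+1%:R * k`!%:R * (n - k.+1)`!%:R) =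
      n%:R * n.-1`!%:R :> K.
    by rewrite -!natrM -factS bin_fact //; case: (n) lt_kn => // n0 _; rewrite factS.
  move/(canRL (mulfK _)) => ->; last by rewrite !mulf_neq0 ?fact_neq0.
  by field; rewrite !fact_neq0 addrC natr1 k0.
by rewrite /matB CE; ring.
Qed.

Lemma matA_hseries nu n k : (k <= n)%N ->
  matA x nu n k = (-1) ^+ n * hseries (- n%:R) (- n%:R * nu) (n - k)%N.
Proof.
move=> le_kn.
have pE : poch (- n%:R : K) (n - k) = (-1) ^+ (n - k) * n`!%:R / k`!%:R.
  by rewrite -poch_natN ?leq_subr // subKn // mulfK ?fact_neq0.
rewrite hseries_hypF pE ?mulf_neq0 ?invr_eq0 ?fact_neq0 ?expf_neq0 ?oppr_eq0 ?oner_eq0 //.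
rewrite /matA mulrA; congr (_ * _).
rewrite -(bin_fact le_kn) !natrM -[X in _ = (-1) ^+ X * _](subnK le_kn) exprD.
have : (-1) ^+ (n - k) * (-1) ^+ (n - k) = 1 :> K by rewrite -expr2 sqrr_sign.
move: ((-1) ^+ (n - k)) => e ee.
have -> : e * (-1) ^+ k * (e * ('C(n, k)%:R * (k`!%:R * (n - k)`!%:R)) / k`!%:R
   / (n - k)`!%:R) = (e * e) * ((-1) ^+ k * 'C(n, k)%:R) by field; rewrite !fact_neq0.
by rewrite ee mul1r.
Qed.

End Series.

(** * The differential equation of H, modulo powers of X *)

Section DifferentialEquation.
Variable K : numFieldType.
Variable x : K.
Implicit Types (b c nu : K) (p q : {poly K}) (i k m n N : nat).

Definition ode_lead : {poly K} := (1 - 'X) * (1 - (1 - x)%:P * 'X).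
Definition ode_rhs c b : {poly K} := c%:P * (1 - (1 - x)%:P * 'X) - (b * x)%:P.

(* The logarithmic derivative of (1 - z)^(b - c) (1 - (1 - x) z)^(-b) is
   ode_rhs c b / ode_lead. *)
Definition ode_sol n c b p :=
  p`_0 = 1 /\ eqX n (ode_lead * p^`()) (ode_rhs c b * p).

Lemma coef0_ode_lead : ode_lead`_0 = 1.
Proof. by rewrite -horner_coef0 /ode_lead !hornerE; ring. Qed.

(** Integration gains one power of X: if X^k divides the difference d, the equation and the
    invertibility of [ode_lead] make X^k divide d', and d has no constant term, so X^(k+1) divides d
    in characteristic 0. *)
Lemma ode_sol_uniq n c b p q :
  ode_sol n c b p -> ode_sol n c b q -> eqX n.+1 p q.
Proof.
move=> [p0 hp] [q0 hq]; have := eqXB hp hq.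
have : (p - q)`_0 = 0 by rewrite coefB p0 q0 subrr.
rewrite /eqX -!mulrBr -derivB; move: (p - q) => d d0 hd.
elim: {-2}n.+1 (leqnn n.+1) => [|k IHk] lt_kn; first by rewrite expr0 dvd1p.
have /IHk dk := ltnW lt_kn.
have {}hd : 'X^k %| ode_lead * d^`().
  have := dvdp_trans (dvdp_exp2l 'X (lt_kn : (k <= n)%N)) hd.
  by rewrite dvdp_subl // dvdp_mull.
have {}hd : 'X^k %| d^`().
  by apply: dvdXn_cancel hd; rewrite coef0_ode_lead oner_eq0.
have h : eqX k d^`() 0 by rewrite /eqX subr0.
have : eqX k.+1 d 0; last by rewrite /eqX subr0.
apply/eqXP => -[|i] lt_ik; rewrite coef0 //.
have /eqXP/(_ i lt_ik) := h; rewrite coef_deriv coef0 => /eqP.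
by rewrite -mulr_natr mulf_eq0 pnatr_eq0 orbF => /eqP.
Qed.

Lemma eqX_deriv n p q : eqX n.+1 p q -> eqX n p^`() q^`().
Proof.
by move=> /eqXP h; apply/eqXP => i lt_in; rewrite !coef_deriv h.
Qed.

(** Logarithmic derivatives add, and [ode_rhs] is additive in (c, b). With uniqueness this replaces
    any convolution identity for the coefficients of H. *)
Lemma ode_solM n c b c' b' p q :
  ode_sol n c b p -> ode_sol n c' b' q -> ode_sol n (c + c') (b + b') (p * q).
Proof.
move=> [p0 hp] [q0 hq]; split; first by rewrite -horner_coef0 hornerM !horner_coef0 p0 q0 mulr1.
have := eqXD (eqXM hp (eqX_refl n q)) (eqXM hq (eqX_refl n p)).
rewrite /eqX; congr (_ %| _); rewrite derivM /ode_rhs.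
by ring.
Qed.

Lemma ode_sol1 n : ode_sol n 0 0 1.
Proof.
split; first by rewrite coefC.
by rewrite -polyC1 derivC mulr0 /ode_rhs !mul0r subrr mul0r eqX_refl.
Qed.

Lemma ode_sol_exp n c b p k :
  ode_sol n c b p -> ode_sol n (k%:R * c) (k%:R * b) (p ^+ k).
Proof.
move=> hp; elim: k => [|k IHk]; first by rewrite !mul0r; exact: ode_sol1.
by rewrite exprS -add1n natrD !mulrDl !mul1r; apply: ode_solM.
Qed.

(* The power series of (1 - z)^(-c). *)
Definition gseries c : fps K := fun i => poch c i / i`!%:R.

Lemma gseriesS n c :
  eqX n ((1 - 'X) * trunc n (gseries (c + 1))) (trunc n (gseries c)).
Proof.
apply/eqXP => i lt_in; rewrite mulrBl mul1r coefB coefXM.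
case: i lt_in => [|i] lt_in.
  by rewrite subr0 !coef_trunc // /gseries /poch !big_ord0.
rewrite !coef_trunc ?(ltnW lt_in) //= /gseries pochS pochSl factS natrM.
by field; rewrite fact_neq0 addrC natr1 pnatr_eq0.
Qed.

Lemma gseries_deriv n c :
  eqX n (trunc n.+1 (gseries c))^`() (c%:P * trunc n.+1 (gseries (c + 1))).
Proof.
apply/eqXP => i lt_in; rewrite coef_deriv coefCM.
rewrite !coef_trunc ?ltnS // 1?ltnW //.
rewrite /gseries pochSl factS natrM -mulr_natr.
by field; rewrite fact_neq0 addrC natr1 pnatr_eq0.
Qed.

Lemma trunc_hseries n c b :
  eqX n (trunc n (hseries x c b))
    (\sum_(m < n) (poch b m / m`!%:R * (- x) ^+ m)%:P *
       ('X^m * trunc n (gseries (c + m%:R)))).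
Proof.
apply/eqXP => N lt_Nn; rewrite coef_trunc // coef_sum /hseries.
rewrite (big_ord_widen n (fun m => poch b m / m`!%:R * (- x) ^+ m *
   (poch (c + m%:R) (N - m) / (N - m)`!%:R))) // big_mkcond /=.
apply: eq_bigr => m _; rewrite coefCM coefXnM ltnS.
case: (ltnP N m) => _; first by rewrite mulr0.
by rewrite coef_trunc // (leq_ltn_trans (leq_subr _ _) lt_Nn).
Qed.

(** H is the sum of the be_m G_m with G_m = z^m (1 - z)^(-c - m); let D be the sum of the m be_m
    G_m. Then (1 - z) z H' = D + c z H, while (m + 1) be_(m+1) = - x (b + m) be_m and (1 - z)
    G_(m+1) = z G_m give (1 - (1 - x) z) D = - b x z H. Eliminating D yields the equation times z,
    and cancelling z costs one order. *)
Lemma hseries_ode n c b : ode_sol n c b (trunc n.+1 (hseries x c b)).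
Proof.
split; first by rewrite coef_trunc // hseries0.
set H := trunc _ _; pose g m := trunc n.+1 (gseries (c + m%:R)).
pose G m := 'X^m * g m; pose be m := poch b m / m`!%:R * (- x) ^+ m.
have HE : eqX n.+1 H (\sum_(m < n.+1) (be m)%:P * G m) := trunc_hseries n.+1 c b.
have gS m : eqX n.+1 ((1 - 'X) * g m.+1) (g m).
  by rewrite /g -natr1 addrA; apply: gseriesS.
have GS m : eqX n.+1 ((1 - 'X) * G m.+1) ('X * G m).
  have -> : (1 - 'X) * G m.+1 = 'X^(m.+1) * ((1 - 'X) * g m.+1) by rewrite /G; ring.
  by rewrite /G exprS -mulrA; do 2![apply: eqXM; first exact: eqX_refl]; exact: gS.
have eqXX p q : eqX n p q -> eqX n.+1 ('X * p) ('X * q).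
  by rewrite /eqX -mulrBr exprS dvdp_mul2l ?polyX_eq0.
have dG m : eqX n.+1 ((1 - 'X) * ('X * (G m)^`())) ((m%:R + c%:P * 'X) * G m).
  have dg : eqX n.+1 ('X * (g m)^`()) ('X * ((c + m%:R)%:P * g m.+1)).
    by apply: eqXX; rewrite /g -natr1 addrA; apply: gseries_deriv.
  have -> : (1 - 'X) * ('X * (G m)^`()) =
      m%:R * (1 - 'X) * G m + 'X^m * (1 - 'X) * ('X * (g m)^`()).
    rewrite /G derivM derivXn; case: m {dg} => [|m]; first by rewrite !mulr0n !expr0; ring.
    by rewrite [m.+1.-1]/= exprS -mulr_natr; ring.
  have -> : (m%:R + c%:P * 'X) * G m =
      m%:R * (1 - 'X) * G m + (c + m%:R)%:P * ('X * G m) by ring.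
  apply: eqXD; first exact: eqX_refl.
  apply: eqX_trans (eqXM (eqX_refl _ _) dg) _.
  have -> : 'X^m * (1 - 'X) * ('X * ((c + m%:R)%:P * g m.+1)) =
    (c + m%:R)%:P * ((1 - 'X) * G m.+1) by rewrite /G exprS; ring.
  by apply: eqXM; [exact: eqX_refl|exact: GS].
pose D := \sum_(m < n.+1) (m%:R * be m)%:P * G m.
have DE : eqX n.+1 ((1 - 'X) * D) (- (b * x)%:P * 'X * H - x%:P * 'X * D).
  have -> : (1 - 'X) * D =
      \sum_(m < n) (m.+1%:R * be m.+1)%:P * ((1 - 'X) * G m.+1).
    rewrite /D big_ord_recl !mul0r add0r mulr_sumr.
    by apply: eq_bigr => m _; rewrite mulrCA.
  apply: (@eqX_trans _ _ (\sum_(m < n) (m.+1%:R * be m.+1)%:P * ('X * G m))).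
    by apply: eqX_sum => m; apply: eqXM; [exact: eqX_refl|exact: GS].
  have beS m : m.+1%:R * be m.+1 = - x * (b + m%:R) * be m.
    rewrite /be pochS factS natrM exprS; field.
    by rewrite fact_neq0 addrC natr1 pnatr_eq0.
  under eq_bigr do rewrite beS.
  apply: eqX_sym.
  apply: eqX_trans (eqXB (eqXM (eqX_refl _ _) HE) (eqX_refl _ _)) _.
  rewrite !mulr_sumr -sumrB big_ord_recr /=.
  rewrite -[X in eqX _ _ X]addr0; apply: eqXD.
    rewrite (eq_bigr (fun m : 'I_n => (- x * (b + m%:R) * be m)%:P * ('X * G m))).
      exact: eqX_refl.
    by move=> m _; ring.
  (* What remains is the term m = n, a multiple of X G_n and hence of X^(n+1). *)
  rewrite /eqX subr0 /G exprS; apply/dvdpP.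
  by exists ((- (b * x)%:P * (be n)%:P - x%:P * (n%:R * be n)%:P) * g n); ring.
have dH : eqX n.+1 ((1 - 'X) * ('X * H^`())) (D + c%:P * 'X * H).
  have dHE : eqX n H^`() (\sum_(m < n.+1) (be m)%:P * (G m)^`()).
    have -> : \sum_(m < n.+1) (be m)%:P * (G m)^`() =
        (\sum_(m < n.+1) (be m)%:P * G m)^`().
      by rewrite raddf_sum; apply: eq_bigr => m _; rewrite /= deriv_mulC.
    exact: eqX_deriv.
  apply: eqX_trans (eqXM (eqX_refl _ _) (eqXX _ _ dHE)) _; apply: eqX_sym.
  apply: eqX_trans (eqXD (eqX_refl _ _) (eqXM (eqX_refl _ _) HE)) _.
  rewrite !mulr_sumr -big_split; apply: eqX_sum => m; apply: eqX_sym => /=.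
  rewrite [X in eqX _ _ X](_ : _ = (be m)%:P * ((m%:R + c%:P * 'X) * G m)); last by ring.
  rewrite [X in eqX _ X _](_ : _ = (be m)%:P * ((1 - 'X) * ('X * (G m)^`()))); last by ring.
  by apply: eqXM; [exact: eqX_refl|exact: dG].
have XdH : eqX n.+1 ('X * (ode_lead * H^`())) ('X * (ode_rhs c b * H)).
  rewrite (_ : 'X * _ = (1 - (1 - x)%:P * 'X) * ((1 - 'X) * ('X * H^`()))); last first.
    by rewrite /ode_lead; ring.
  apply: eqX_trans (eqXM (eqX_refl _ _) dH) _.
  have := eqXD DE (eqX_refl n.+1
    (x%:P * 'X * D + (1 - (1 - x)%:P * 'X) * (c%:P * 'X * H))).
  by rewrite /eqX; congr (_ %| _); rewrite /ode_rhs; ring.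
by move: XdH; rewrite /eqX -mulrBr exprS dvdp_mul2l ?polyX_eq0.
Qed.

End DifferentialEquation.

(** * Lagrange inversion *)

Section Inversion.
Variable K : numFieldType.
Variables x nu : K.
Implicit Types (a b c : K) (p q : {poly K}) (S T w : nat -> K) (i k m n N : nat).

Lemma hseriesM n c b c' b' :
  eqX n (trunc n (hseries x c b) * trunc n (hseries x c' b'))
    (trunc n (hseries x (c + c') (b + b'))).
Proof.
have := ode_sol_uniq (ode_solM (hseries_ode x n c b) (hseries_ode x n c' b'))
  (hseries_ode x n (c + c') (b + b')).
move/(eqX_leq (leqnSn n)) => h; have tr (f : fps K) : eqX n (trunc n.+1 f) (trunc n f).
  exact: eqX_trunc.
apply: eqX_trans _ (eqX_trans h (tr _)); apply: eqX_sym; apply: eqXM; exact: tr.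
Qed.

Lemma hseriesX n k c b :
  eqX n (trunc n (hseries x c b) ^+ k) (trunc n (hseries x (k%:R * c) (k%:R * b))).
Proof.
have := ode_sol_uniq (ode_sol_exp k (hseries_ode x n c b))
  (hseries_ode x n (k%:R * c) (k%:R * b)).
move/(eqX_leq (leqnSn n)) => h; have tr (f : fps K) : eqX n (trunc n.+1 f) (trunc n f).
  exact: eqX_trunc.
apply: eqX_trans _ (eqX_trans h (tr _)); apply: eqX_sym; apply: eqX_exp; exact: tr.
Qed.

(** With w = z H_{1,nu}, the sum is the coefficient of z^(-1) in (w^j)' w^(-j - m). For m > 0 this
    is -j/m times the derivative of w^(-m), without residue; for m = 0 it is j w' / w, of residue
    j. *)
Lemma hseries_lagrange j m :
  \sum_(i < m.+1) (j + i)%:R * hseries x j%:R (j%:R * nu) i *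
     hseries x (- (j + m)%:R) (- (j + m)%:R * nu) (m - i)%N = (j * (m == 0))%:R.
Proof.
case: m => [|m].
  by rewrite big_ord1 !addn0 !hseries0 !mulr1 muln1.
rewrite muln0; set M := m.+1.
pose p := trunc M.+1 (hseries x j%:R (j%:R * nu)).
pose q := trunc M.+1 (hseries x (- (j + M)%:R) (- (j + M)%:R * nu)).
pose r := trunc M.+1 (hseries x (- M%:R) (- M%:R * nu)).
have pq : eqX M.+1 (p * q) r.
  have := hseriesM M.+1 j%:R (j%:R * nu) (- (j + M)%:R) (- (j + M)%:R * nu).
  have -> : j%:R - (j + M)%:R = - M%:R :> K by rewrite natrD; ring.
  by have -> : j%:R * nu + - (j + M)%:R * nu = - M%:R * nu by rewrite natrD; ring.
have [_ pE] := hseries_ode x M j%:R (j%:R * nu).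
have [_ rE] := hseries_ode x M (- M%:R) (- M%:R * nu).
(* The logarithmic derivatives of p and r are j and -M times that of H_{1,nu}, so M p' / p = - j r'
   / r; moreover r = p q. *)
have step : eqX M (M%:R * (p^`() * q)) (- j%:R * r^`()).
  apply: (@eqX_cancel _ _ (ode_lead x)); first by rewrite coef0_ode_lead oner_eq0.
  have := eqXD (eqXM (eqX_refl M (M%:R * q)) pE) (eqXM (eqX_refl M j%:R) rE).
  move/eqX_trans/(_ (eqXD (eqX_refl _ (M%:R * q * (ode_rhs x j%:R (j%:R * nu) * p)))
     (eqXM (eqX_refl M j%:R) (eqXM (eqX_refl _ (ode_rhs x (- M%:R) (- M%:R * nu)))
       (eqX_sym (eqX_leq (leqnSn M) pq)))))).
  by rewrite /eqX; congr (_ %| _); rewrite /ode_rhs -/p -/r; ring.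
have : eqX M.+1 (M%:R * ((j%:R * p + 'X * p^`()) * q)) (j%:R * (M%:R * r - 'X * r^`())).
  have Xstep : eqX M.+1 ('X * (M%:R * (p^`() * q))) ('X * (- j%:R * r^`())).
    by move: step; rewrite /eqX -mulrBr exprS dvdp_mul2l ?polyX_eq0.
  have := eqXD Xstep (eqXM (eqX_refl _ (M%:R * j%:R)) pq).
  by rewrite /eqX; congr (_ %| _); ring.
(* The vanishing residue: the coefficient of X^M in M r - X r' is M r_M - M r_M. *)
move=> /eqXP/(_ M (ltnSn M)).
rewrite -!polyC_natr !coefCM coefB coefCM coefXM /= coef_deriv -[r`_m.+1 *+ m.+1]mulr_natl subrr mulr0.
move=> /eqP; rewrite mulf_eq0 pnatr_eq0 /= coefM => /eqP h; rewrite -[RHS]h.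
apply: eq_bigr => i _; rewrite coefD coefCM coefXM coef_deriv.
rewrite [q`_(_)]coef_trunc ?ltnS ?leq_subr //; congr (_ * _).
have -> : (if i == 0%N :> nat then 0 else p`_i.-1.+1 *+ i.-1.+1) = i%:R * p`_i.
  by case: (nat_of_ord i) => [|k]; rewrite ?mul0r // mulr_natl.
by rewrite natrD mulrDl coef_trunc.
Qed.

Lemma matB_gt n k : (n < k)%N -> matB x nu n k = 0.
Proof. by move=> lt_nk; rewrite /matB bin_small // mulr0 mul0r. Qed.

(** The factor k / j of B_{k,j}, with k = j + i, supplies the weight j + i of [hseries_lagrange];
    the signs combine to (-1)^(n - j). *)
Lemma mat_mulAB n j : (0 < j <= n)%N ->
  \sum_(1 <= k < n.+1) matA x nu n k * matB x nu k j = (n == j)%:R.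
Proof.
move=> /andP[j0 le_jn].
rewrite (big_cat_nat (n := j)) //=; last exact: ltnW.
rewrite big_nat_cond big1 ?add0r; last first.
  by move=> k /andP[/andP[_ lt_kj] _]; rewrite matB_gt // mulr0.
pose m := (n - j)%N; have -> : n = (j + m)%N by rewrite subnKC.
rewrite -{1}[j]add0n big_addn subSn ?leq_addr // addKn big_mkord.
have jn0 : j%:R != 0 :> K by rewrite pnatr_eq0 -lt0n.
rewrite (eq_bigr (fun i : 'I_m.+1 => (-1) ^+ m / j%:R *
  ((j + i)%:R * hseries x j%:R (j%:R * nu) i *
     hseries x (- (j + m)%:R) (- (j + m)%:R * nu) (m - i)%N))); last first.
  move=> i _; rewrite matA_hseries; last by rewrite addnC leq_add2l -ltnS.
  rewrite matB_hseries ?j0 ?leq_addl // addnK.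
  have -> : (j + m - (i + j) = m - i)%N by rewrite [(i + j)%N]addnC subnDl.
  rewrite [(i + j)%N]addnC exprD.
  have : (-1) ^+ j * (-1) ^+ j = 1 :> K by rewrite -expr2 sqrr_sign.
  move: ((-1) ^+ j) => e ee.
  by apply: etrans (etrans (congr1 (fun t => t * _) ee) (mul1r _)); field.
rewrite -mulr_sumr hseries_lagrange -[X in _ = (_ == X)%:R]addn0 eqn_add2l.
case: (m) => [|m'] /=; last by rewrite muln0 mulr0.
by rewrite muln1 expr0 mul1r mulVf.
Qed.

Lemma mat_applyAB T n : (0 < n)%N ->
  mat_apply (matA x nu) (mat_apply (matB x nu) T) n = T n.
Proof.
move=> n0; rewrite /mat_apply.
rewrite (eq_big_nat _ _ (F2 := fun k =>
    \sum_(1 <= j < n.+1) matA x nu n k * matB x nu k j * T j)); last first.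
  move=> k /andP[k0 le_kn]; rewrite mulr_sumr.
  rewrite [RHS](big_cat_nat (n := k.+1)) //= [X in _ = _ + X]big_nat_cond.
  rewrite [X in _ = _ + X]big1 ?addr0.
    by apply: eq_bigr => j _; rewrite mulrA.
  by move=> j /andP[/andP[lt_kj _] _]; rewrite matB_gt // mulr0 mul0r.
rewrite exchange_big_nat /=.
rewrite (eq_big_nat _ _ (F2 := fun j => (n == j)%:R * T j)); last first.
  by move=> j /mat_mulAB <-; rewrite mulr_suml.
rewrite big_nat_recr //= eqxx mul1r big_nat_cond big1 ?add0r // => j.
by move=> /andP[/andP[_ lt_jn] _]; rewrite gtn_eqF // mul0r.
Qed.

(** From A B = 1 one gets A (B T) = T = A S. Strong induction cancels A, which is triangular with
    diagonal entries (-1)^n. *)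
Lemma mat_apply_inv S T :
  (forall n, (0 < n)%N -> T n = mat_apply (matA x nu) S n) ->
  forall n, (0 < n)%N -> S n = mat_apply (matB x nu) T n.
Proof.
move=> TS n; elim/ltn_ind: n => n IHn n0.
have := mat_applyAB T n0; rewrite [RHS](TS _ n0) /mat_apply !big_nat_recr //=.
rewrite (eq_big_nat _ _ (F2 := fun k => matA x nu n k * S k)); last first.
  by move=> k /andP[k0 lt_kn]; rewrite (IHn k).
move/addrI/esym; apply: mulfI.
by rewrite matA_hseries // subnn hseries0 mulr1 expf_neq0 // oppr_eq0 oner_eq0.
Qed.

End Inversion.

(** * The generating series identities *)

Section GeneratingSeries.
Variable K : numFieldType.
Variables x nu : K.
Implicit Types (a b c : K) (p q : {poly K}) (S T : nat -> K) (f g w : fps K).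
Implicit Types (i k m n N : nat).

Lemma trunc_div n f g : g 0%N != 0 ->
  eqX n (trunc n g * trunc n (f / g)%fps) (trunc n f).
Proof.
move=> g0; apply: eqX_trans (eqXM (eqX_refl _ _) (truncM _ _ _)) _.
have := eqXM (eqX_refl n (trunc n f)) (truncV n g0).
by rewrite mulr1 mulrCA.
Qed.

Lemma eqX_prefactor_den n p q : eqX n p q ->
  eqX n ((1 - p) * (1 - (1 - x)%:P * p)) ((1 - q) * (1 - (1 - x)%:P * q)).
Proof.
rewrite /eqX; set d := _ - _ => /dvdpP[r dE].
rewrite (_ : _ - _ = d * (- (2 - x)%:P + (1 - x)%:P * (p + q))); last by rewrite /d; ring.
by rewrite dvdp_mulr // dE dvdp_mull.
Qed.

Lemma eqX_prefactor_num n p q : eqX n p q ->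
  eqX n ((1 - nu)%:P * (1 - (1 - x)%:P * p) + nu%:P * (1 - p))
    ((1 - nu)%:P * (1 - (1 - x)%:P * q) + nu%:P * (1 - q)).
Proof.
rewrite /eqX; set d := _ - _ => /dvdpP[r dE].
rewrite (_ : _ - _ = d * (- ((1 - nu) * (1 - x))%:P - nu%:P)); last by rewrite /d; ring.
by rewrite dvdp_mulr // dE dvdp_mull.
Qed.

(** With its denominators cleared, the bracket is characterised by a polynomial congruence, which
    can be multiplied by [ode_lead] data and composed. *)
Lemma prefactor_trunc n w : w 0%N = 0 ->
  eqX n ((1 - trunc n w) * (1 - (1 - x)%:P * trunc n w) * trunc n (prefactor x nu w))
    ((1 - nu)%:P * (1 - (1 - x)%:P * trunc n w) + nu%:P * (1 - trunc n w)).
Proof.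
move=> w0; set W := trunc n w.
set g1 : fps K := (fpsC 1 - w)%fps; set g2 : fps K := (fpsC 1 - fpsC (1 - x) * w)%fps.
have g10 : g1 0%N != 0 by rewrite /g1 /fps_sub w0 subr0 oner_eq0.
have g20 : g2 0%N != 0.
  by rewrite /g2 /fps_sub /fps_mul big_ord1 subnn w0 mulr0 subr0 oner_eq0.
have h1 : eqX n (trunc n g1) (1 - W).
  by rewrite truncB; apply: eqXB; [rewrite -polyC1; exact: truncC|exact: eqX_refl].
have h2 : eqX n (trunc n g2) (1 - (1 - x)%:P * W).
  rewrite truncB; apply: eqXB; first by rewrite -polyC1; exact: truncC.
  apply: eqX_trans (truncM _ _ _) _.
  by apply: eqXM; [exact: truncC|exact: eqX_refl].
rewrite /prefactor -/g1 -/g2 truncD.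
have d1 := eqX_trans (trunc_div n (fpsC (1 - nu)) g10) (truncC _ _).
have d2 := eqX_trans (trunc_div n (fpsC nu) g20) (truncC _ _).
set P1 := trunc n (_ / g1)%fps in d1 *; set P2 := trunc n (_ / g2)%fps in d2 *.
rewrite [X in eqX _ X _](_ : _ = (1 - (1 - x)%:P * W) * ((1 - W) * P1) +
  (1 - W) * ((1 - (1 - x)%:P * W) * P2)); last by ring.
rewrite [X in eqX _ _ (X + _)]mulrC [X in eqX _ _ (_ + X)]mulrC.
apply: eqXD; (apply: eqXM; first exact: eqX_refl).
  exact: eqX_trans (eqXM (eqX_sym h1) (eqX_refl _ _)) d1.
exact: eqX_trans (eqXM (eqX_sym h2) (eqX_refl _ _)) d2.
Qed.

Lemma coef_prefactor_exp n Xi_s k i : (0 < k)%N -> (i < n)%N ->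
  eqX n (trunc n Xi_s) (- 'X * trunc n (hseries x 1 nu)) ->
  (trunc n (prefactor x nu (fpsX K)) * trunc n Xi_s ^+ k)`_i = matB x nu i k.
Proof.
move=> k0 lt_in hXi; set P := trunc n _.
(* One coefficient more than the modulus, because H' occurs below. *)
pose H := trunc n.+1 (hseries x k%:R (k%:R * nu)).
have HE : eqX n (trunc n (hseries x 1 nu) ^+ k) H.
  apply: eqX_trans (hseriesX x n k 1 nu) _; rewrite mulr1.
  by apply: eqX_sym; apply: eqX_trunc.
have k0' : k%:R != 0 :> K by rewrite pnatr_eq0 -lt0n.
(* This is P = z Xi' / Xi: H is the k-th power of -Xi / z, so P = 1 + z H' / (k H). Multiplying by
   [ode_lead] turns both P and H' into explicit expressions. *)
have PH : eqX n (k%:R * (P * H)) (k%:R * H + 'X * H^`()).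
  apply: (@eqX_cancel _ _ (ode_lead x)); first by rewrite coef0_ode_lead oner_eq0.
  have X1 : eqX n (trunc n (fpsX K)) 'X := truncX K n.
  have hP : eqX n (ode_lead x * P)
      ((1 - nu)%:P * (1 - (1 - x)%:P * 'X) + nu%:P * (1 - 'X)).
    apply: eqX_trans (eqX_trans (prefactor_trunc n (erefl : fpsX K 0%N = 0))
      (eqX_prefactor_num X1)).
    exact/eqXM/eqX_refl/eqX_sym/eqX_prefactor_den.
  have [_ HO] := hseries_ode x n k%:R (k%:R * nu).
  have := eqXB (eqXM hP (eqX_refl n (k%:R * H))) (eqXM (eqX_refl _ 'X) HO).
  by rewrite /eqX; congr (_ %| _); rewrite /ode_lead /ode_rhs -/H; ring.
have step : eqX n (k%:R * (P * trunc n Xi_s ^+ k))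
    ((-1) ^+ k * ('X^k * (k%:R * H + 'X * H^`()))).
  have hk : eqX n (trunc n Xi_s ^+ k) ((-1) ^+ k * ('X^k * H)).
    apply: eqX_trans (eqX_exp k hXi) _; rewrite exprMn [(- 'X) ^+ k]exprNn mulrA.
    by apply: eqXM; [exact: eqX_refl|exact: HE].
  rewrite mulrA; apply: eqX_trans (eqXM (eqX_refl _ _) hk) _.
  have := eqXM (eqX_refl _ ((-1) ^+ k * 'X^k)) PH.
  by rewrite /eqX; congr (_ %| _); ring.
have {}step : k%:R * (P * trunc n Xi_s ^+ k)`_i =
    ((-1) ^+ k * ('X^k * (k%:R * H + 'X * H^`())))`_i.
  by rewrite -coefCM polyC_natr; apply/eqXP: i lt_in.
apply: (mulfI k0'); rewrite {}step.
rewrite (_ : (-1) ^+ k = ((-1) ^+ k)%:P); last by rewrite rmorph_sign.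
rewrite coefCM coefXnM; case: ltnP => [lt_ik|le_ki].
  by rewrite matB_gt // !mulr0.
rewrite coefD (_ : (k%:R * H)`_(i - k) = k%:R * H`_(i - k)); last first.
  by rewrite -coefCM polyC_natr.
rewrite coefXM.
have -> : (if (i - k == 0)%N then 0 else H^`()`_(i - k).-1) = (i - k)%:R * H`_(i - k).
  by case: (i - k)%N => [|l]; rewrite ?mul0r //= coef_deriv mulr_natl.
(* The weights k and i - k add up to i, which gives the factor i / k of B_{i,k}. *)
rewrite matB_hseries ?k0 // -mulrDl -natrD subnKC // coef_trunc; last first.
  by rewrite ltnS (leq_trans (leq_subr _ _)) // ltnW.
by field.
Qed.

Lemma gen_series_B n S T Xi_s :
  (forall n, (0 < n)%N -> S n = mat_apply (matB x nu) T n) ->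
  eqX n (trunc n Xi_s) (- 'X * trunc n (hseries x 1 nu)) ->
  eqX n (trunc n (gen_series S))
    (trunc n (prefactor x nu (fpsX K)) * (trunc n (gen_series T) \Po trunc n Xi_s)).
Proof.
move=> ST hXi; apply/eqXP => i lt_in; rewrite comp_trunc mulr_sumr coef_sum coef_trunc //.
rewrite (eq_bigr (fun k : 'I_n => gen_series T k * matB x nu i k)); last first.
  move=> k _; rewrite -scalerAr coefZ; rewrite /gen_series; case: (posnP k) => [->|k0]; first by rewrite !mul0r.
  by rewrite coef_prefactor_exp // gtn_eqF.
clear hXi; case: n lt_in => // n lt_in; rewrite big_ord_recl mul0r add0r.
case: i lt_in => [|i] lt_in.
  by rewrite big1 // => k _; rewrite matB_gt ?mulr0.
rewrite [LHS](ST i.+1) // /mat_apply big_add1 /= big_mkord.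
rewrite (big_ord_widen n (fun k => matB x nu i.+1 k.+1 * T k.+1)) // big_mkcond /=.
apply: eq_bigr => k _; rewrite /bump /= add1n.
case: ltnP => [_|lt_ik]; first by rewrite mulrC.
by rewrite matB_gt ?mulr0 // ltnS.
Qed.

Lemma gen_series_inv n S T Xi_s Omega_s :
  Xi_s 0%N = 0 -> Omega_s 0%N = 0 ->
  eqX n (trunc n Xi_s \Po trunc n Omega_s) 'X ->
  eqX n (trunc n (gen_series S))
    (trunc n (prefactor x nu (fpsX K)) * (trunc n (gen_series T) \Po trunc n Xi_s)) ->
  eqX n (trunc n (gen_series T))
    (trunc n ((gen_series S \o Omega_s) * (prefactor x nu Omega_s)^-1)%fps).
Proof.
move=> Xi0 Om0 hOm hS; set O := trunc n Omega_s in hOm *.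
have O0 : O`_0 = 0 by rewrite coef0_trunc.
set P := trunc n (prefactor x nu (fpsX K)) in hS.
set Q := trunc n (prefactor x nu Omega_s).
have pref0 : prefactor x nu Omega_s 0%N = 1.
  rewrite /prefactor /fps_add /fps_mul !big_ord1 !subnn /fps_inv /= /fps_sub.
  by rewrite /fps_mul big_ord1 Om0 mulr0 subr0 invr1 !mulr1 subrK.
have lead0 : ((1 - O) * (1 - (1 - x)%:P * O))`_0 != 0.
  rewrite -horner_coef0 !hornerE.
  by have := O0; rewrite -horner_coef0 => ->; rewrite mulr0 subr0 mulr1 oner_eq0.
(* Composing the cleared congruence of P with O gives that of Q; the common factor has constant term
   1 and cancels. *)
have PQ : eqX n (P \Po O) Q.
  apply: eqX_cancel lead0 _.
  apply: eqX_trans (eqX_sym (prefactor_trunc n Om0)).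
  have XO : eqX n (trunc n (fpsX K) \Po O) O.
    by rewrite -[X in eqX _ _ X]comp_polyX; apply: eqX_compl => //; exact: truncX.
  have := eqX_compl O0 (prefactor_trunc n (erefl : fpsX K 0%N = 0)).
  rewrite !(comp_polyB, comp_polyM, comp_polyC) ?comp_polyD !(comp_polyB, comp_polyM, comp_polyC) !polyC1.
  move=> h; apply: eqX_trans (eqX_trans h (eqX_prefactor_num XO)).
  exact/eqXM/eqX_refl/eqX_sym/eqX_prefactor_den.
have hT : eqX n (trunc n (gen_series S) \Po O) (Q * trunc n (gen_series T)).
  apply: eqX_trans (eqX_compl O0 hS) _; rewrite comp_polyM -comp_polyA.
  by apply: eqXM => //; rewrite -[X in eqX _ _ X]comp_polyXr; apply: eqX_compr.
apply: eqX_sym; apply: eqX_trans (truncM _ _ _) _.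
apply: eqX_trans (eqXM (eqX_trans (trunc_comp _ _ Om0) hT) (eqX_refl _ _)) _.
have := eqXM (truncV n (_ : prefactor x nu Omega_s 0%N != 0)) (eqX_refl _ (trunc n (gen_series T))).
rewrite pref0 oner_eq0 => /(_ isT); rewrite mul1r mulrAC.
exact.
Qed.

End GeneratingSeries.

(** * Formal exponential of a multiple of the logarithm *)

Section FormalPower.
Variable K : numFieldType.
Variable x : K.
Implicit Types (a : K) (n : nat).

Definition eseries : fps K := fun i => (i`!%:R)^-1.

(* The power series of the logarithm of (1 - z) / (1 - (1 - x) z); its constant
   term vanishes because 0^-1 = 0. *)
Definition lseries : fps K := fun m => ((1 - x) ^+ m - 1) / m%:R.

Lemma eseries_deriv n : eqX n (trunc n.+1 eseries)^`() (trunc n.+1 eseries).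
Proof.
apply/eqXP => i lt_in; rewrite coef_deriv !coef_trunc // ?(ltnW lt_in) //; last exact: ltnW.
rewrite /eseries factS natrM -mulr_natl.
by field; rewrite fact_neq0 addrC natr1 pnatr_eq0.
Qed.

Lemma lseries_deriv n : eqX n (ode_lead x * (trunc n.+1 lseries)^`()) (- x)%:P.
Proof.
apply/eqXP => i lt_in.
have cE k : (k < n)%N -> (trunc n.+1 lseries)^`()`_k = (1 - x) ^+ k.+1 - 1.
  move=> lt_kn; rewrite coef_deriv coef_trunc // /lseries -[LHS]mulr_natr.
  by rewrite divfK ?pnatr_eq0.
have -> : ode_lead x = 1 - (2 - x)%:P * 'X + (1 - x)%:P * 'X^2.
  by rewrite /ode_lead; ring.
rewrite mulrDl mulrBl mul1r -!mulrA coefD coefB !coefCM !coefXM coefC.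
case: i lt_in => [|[|i]] lt_in /=; rewrite ?cE //=; try exact: ltnW.
- by rewrite !mulr0; ring.
- by rewrite mulr0; ring.
- by rewrite !exprS; ring.
- exact/ltnW/ltnW.
Qed.

(** The formal version of w^a = exp(a log w) for w = (1 - z) / (1 - (1 - x) z). Both sides solve the
    equation of parameters (0, a), since [ode_lead x] times the derivative of a [lseries x] is - a
    x. *)
Lemma exp_lseries n a :
  eqX n.+1 (trunc n.+1 eseries \Po (a%:P * trunc n.+1 lseries))
    (trunc n.+1 (hseries x 0 a)).
Proof.
apply: (@ode_sol_uniq _ x _ 0 a _ _ _ (hseries_ode x n 0 a)).
set L := _ * _; have L0 : L`_0 = 0.
  by rewrite coefCM coef_trunc // /lseries invr0 !mulr0.
split.
  by rewrite -horner_coef0 horner_comp horner_coef0 L0 horner_coef0 coef_trunc // /eseries invr1.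
rewrite deriv_comp /L deriv_mulC -/L /ode_rhs.
have h1 := eqX_compl L0 (eseries_deriv n).
have := eqXM (eqXM h1 (lseries_deriv n)) (eqX_refl n a%:P).
by rewrite /eqX; congr (_ %| _); ring.
Qed.

End FormalPower.

(** * Asymptotic expansions at 0 *)

Section AsymptoticExpansions.
Variable K : numFieldType.
Implicit Types (f g : K -> K) (p q : {poly K}) (m n : nat).

(** The point 0 belongs to the neighbourhood: for n > 0 the bound forces f 0 = 0, and [bigO0_comp]
    may meet points where the inner function vanishes. The field is general because both [R] and
    [R[i]] occur. *)
Definition bigO0 n f :=
  exists2 C : K, 0 <= C & \forall z \near (0 : K^o), `|f z| <= C * `|z| ^+ n.

Definition expands n f p := bigO0 n (fun z => f z - p.[z]).

Lemma near0_lt (e : K) : 0 < e -> \forall z \near (0 : K^o), `|z| < e.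
Proof. exact: (@nbhs0_lt K K^o). Qed.

Lemma bigO0_near n f g :
  (\forall z \near (0 : K^o), f z = g z) -> bigO0 n f -> bigO0 n g.
Proof.
move=> fg [C C0 fC]; exists C => //.
by near=> z; rewrite -(_ : f z = g z); near: z.
Unshelve. all: by end_near. Qed.

Lemma eq_bigO0 n f g : f =1 g -> bigO0 n f -> bigO0 n g.
Proof. by move=> fg; apply: bigO0_near; near=> z. Unshelve. all: by end_near. Qed.

Lemma bigO0D n f g : bigO0 n f -> bigO0 n g -> bigO0 n (fun z => f z + g z).
Proof.
move=> [C C0 fC] [D D0 gD]; exists (C + D); first exact: addr_ge0.
near=> z; rewrite (le_trans (ler_normD _ _)) // mulrDl lerD //; by near: z.
Unshelve. all: by end_near. Qed.

Lemma bigO0M m n f g :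
  bigO0 m f -> bigO0 n g -> bigO0 (m + n) (fun z => f z * g z).
Proof.
move=> [C C0 fC] [D D0 gD]; exists (C * D); first exact: mulr_ge0.
near=> z; rewrite normrM exprD mulrACA ler_pM //; by near: z.
Unshelve. all: by end_near. Qed.

Lemma bigO0_leq m n f : (m <= n)%N -> bigO0 n f -> bigO0 m f.
Proof.
move=> le_mn [C C0 fC]; exists C => //; near=> z.
have z1 : `|z| <= 1 by apply: ltW; near: z; apply: near0_lt.
apply: (@le_trans _ _ (C * `|z| ^+ n)); first by near: z.
by rewrite ler_wpM2l // ler_wiXn2l.
Unshelve. all: by end_near. Qed.

Lemma bigO0_id : bigO0 1 id.
Proof. by exists 1 => //; near=> z; rewrite mul1r. Unshelve. all: by end_near. Qed.

Lemma bigO0_cst (c : K) : bigO0 0 (fun=> c).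
Proof. by exists `|c| => //; near=> z; rewrite mulr1. Unshelve. all: by end_near. Qed.

Lemma bigO0_horner p : bigO0 0 (horner p).
Proof.
elim/poly_ind: p => [|p c IHp].
  by apply: eq_bigO0 (bigO0_cst 0) => z; rewrite horner0.
apply: eq_bigO0 (bigO0D (bigO0M IHp (bigO0_leq (leq0n 1) bigO0_id)) (bigO0_cst c)) => z.
by rewrite hornerMXaddC.
Qed.

Lemma bigO0_dvdXn n p : 'X^n %| p -> bigO0 n (horner p).
Proof.
case/dvdpP => q ->; have id_n : bigO0 n (fun z => z ^+ n).
  by exists 1 => //; near=> z; rewrite normrX mul1r.
by apply: eq_bigO0 (bigO0M (bigO0_horner q) id_n) => z; rewrite hornerM hornerXn.
Unshelve. all: by end_near. Qed.

Lemma bigO0_at0 n f : bigO0 n.+1 f -> f 0 = 0.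
Proof.
move=> [C C0 /nbhs_singleton]; rewrite normr0 expr0n mulr0 normr_le0.
by move/eqP.
Qed.

Lemma bigO0_small n f (e : K) :
  bigO0 n.+1 f -> 0 < e -> \forall z \near (0 : K^o), `|f z| < e.
Proof.
move=> /(bigO0_leq (ltn0Sn n))[C C0 fC] e0.
have C1 : 0 < C + 1 by rewrite ltr_wpDl.
near=> z.
apply: (@le_lt_trans _ _ (C * `|z|)); first by rewrite -[`|z|]expr1; near: z.
have : `|z| < e / (C + 1) by near: z; apply: near0_lt; rewrite divr_gt0.
rewrite ltr_pdivlMr // => h; apply: le_lt_trans h; rewrite mulrC.
by rewrite ler_wpM2l // lerDl.
Unshelve. all: by end_near. Qed.

Lemma bigO0_comp n f g :
  bigO0 n f -> bigO0 1 g -> bigO0 n (fun z => f (g z)).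
Proof.
move=> [C C0 fC] gO; have [D D0 gD] := gO.
exists (C * D ^+ n); first by rewrite mulr_ge0 ?exprn_ge0.
have /nbhs_ballP[e /= e0 he] := fC; near=> z.
apply: (@le_trans _ _ (C * `|g z| ^+ n)).
  apply: he; rewrite -ball_normE /= sub0r normrN.
  by near: z; apply: bigO0_small gO e0.
rewrite -mulrA -exprMn ler_wpM2l // lerXn2r ?nnegrE ?mulr_ge0 //.
by rewrite -[`|z|]expr1; near: z.
Unshelve. all: by end_near. Qed.

Lemma near0_ex_gt0 (P : K -> Prop) :
  (\forall z \near (0 : K^o), P z) -> exists2 z, 0 < z & P z.
Proof.
move=> /nbhs_ballP[d /= d0 hd]; exists (d / 2); first by rewrite divr_gt0.
apply: hd; rewrite -ball_normE /= sub0r normrN gtr0_norm ?divr_gt0 //.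
by rewrite ltr_pdivrMr // ltr_pMr // ltr1n.
Qed.

(** This is what makes expansions unique. A factor X is split off at each step of the induction. *)
Lemma bigO0_horner_dvdXn n p : bigO0 n (horner p) -> 'X^n %| p.
Proof.
elim: n p => [|n IHn] p pO; first by rewrite expr0 dvd1p.
have : 'X %| p.
  by rewrite -['X]subr0 dvdp_XsubCl /root (bigO0_at0 pO).
case/dvdpP => q pE; rewrite pE mulrC exprS dvdp_mul2l ?polyX_eq0 // in pO *.
apply: IHn; case: n pO => [_|n [C C0 hC]]; first exact: bigO0_horner.
have hq z : z != 0 -> `|('X * q).[z]| <= C * `|z| ^+ n.+2 -> `|q.[z]| <= C * `|z| ^+ n.+1.
  move=> z0; rewrite hornerM hornerX normrM exprS mulrCA ler_pM2l //.
  by rewrite normr_gt0.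
(* Dividing the bound by z loses the point 0, where q must be shown to vanish by continuity. *)
suff q0 : q.[0] = 0.
  exists C => //; near=> z; have [->|z0] := eqVneq z 0.
    by rewrite q0 normr0 expr0n mulr0.
  by apply: hq => //; near: z.
apply/eqP; apply/negP => /negP q0.
have e0 : 0 < `|q.[0]| / 2 by rewrite divr_gt0 // normr_gt0.
have d1 : bigO0 1 (fun z => q.[z] - q.[0]).
  have : 'X^1 %| q - (q.[0])%:P.
    by rewrite expr1 -['X]subr0 dvdp_XsubCl /root !hornerE subrr.
  by move/bigO0_dvdXn; apply: eq_bigO0 => z; rewrite !hornerE.
have d2 : bigO0 1 (fun z => C * z ^+ n.+1).
  have := bigO0_dvdXn (_ : 'X^1 %| C%:P * 'X^(n.+1)).
  rewrite dvdp_mull ?dvdp_exp2l // => /(_ isT).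
  by apply: eq_bigO0 => z; rewrite !hornerE.
(* If q(0) were nonzero, some z > 0 would have both |q(z) - q(0)| and |q(z)| below |q(0)| / 2. *)
have : \forall z \near (0 : K^o), [/\ `|q.[z] - q.[0]| < `|q.[0]| / 2,
    `|C * z ^+ n.+1| < `|q.[0]| / 2 & `|('X * q).[z]| <= C * `|z| ^+ n.+2].
  by near=> z; split; near: z; [exact: bigO0_small d1 e0|exact: bigO0_small d2 e0|].
move=> /near0_ex_gt0[z /lt0r_neq0 z0 [h1 h2 /(hq _ z0) h3]].
have : `|q.[0]| < `|q.[0]|.
  rewrite [X in _ < X]splitr -[X in `|X| < _](subKr q.[z]).
  rewrite (le_lt_trans (ler_normB _ _)) // ltrD //.
  by rewrite (le_lt_trans h3) // -[C]ger0_norm // -normrX -normrM.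
by rewrite ltxx.
Unshelve. all: by end_near. Qed.

End AsymptoticExpansions.

Section Expansions.
Variable K : numFieldType.
Implicit Types (f g : K -> K) (p q : {poly K}) (m n : nat).

Lemma bigO0N n f : bigO0 n f -> bigO0 n (fun z => - f z).
Proof.
by move=> /(bigO0M (bigO0_cst (-1))); apply: eq_bigO0 => z; rewrite mulN1r.
Qed.

Lemma expands_bounded n f p : expands n f p -> bigO0 0 f.
Proof.
move=> /(bigO0_leq (leq0n n)) h.
by apply: eq_bigO0 (bigO0D h (bigO0_horner p)) => z; rewrite subrK.
Qed.

Lemma expands_horner n p : expands n (horner p) p.
Proof.
have := bigO0_dvdXn (dvdp0 ('X^n : {poly K})).
by apply: eq_bigO0 => z; rewrite horner0 subrr.
Qed.

Lemma expandsM n f p g q :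
  expands n f p -> expands n g q -> expands n (fun z => f z * g z) (p * q).
Proof.
move=> fp gq; have f0 := expands_bounded fp.
have := bigO0M fp (bigO0_horner q); rewrite addn0 => h.
apply: eq_bigO0 (bigO0D (bigO0M f0 gq) h) => z; rewrite hornerM.
by ring.
Qed.

Lemma expands_eqX n f p q : expands n f p -> eqX n p q -> expands n f q.
Proof.
move=> fp /bigO0_dvdXn pq; apply: eq_bigO0 (bigO0D fp pq) => z.
by rewrite hornerD hornerN; ring.
Qed.

Lemma expands_uniq n f p q : expands n f p -> expands n f q -> eqX n p q.
Proof.
move=> fp fq; apply: bigO0_horner_dvdXn.
apply: eq_bigO0 (bigO0D fq (bigO0N fp)) => z.
by rewrite hornerD hornerN; ring.
Qed.

Lemma expands_near n f g p :
  (\forall z \near (0 : K^o), f z = g z) -> expands n f p -> expands n g p.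
Proof.
by move=> fg; apply: bigO0_near; near=> z; congr (_ - _); near: z.
Unshelve. all: by end_near. Qed.

(** An order of at least 1 and q(0) = 0 give g = O(z), so f(g) - p(g) is small enough; p(g) itself
    is expanded by sums and products. *)
Lemma expands_comp n f g p q :
  q`_0 = 0 -> expands n.+1 f p -> expands n.+1 g q ->
  expands n.+1 (fun z => f (g z)) (p \Po q).
Proof.
move=> q0 fp gq; have g1 : bigO0 1 g.
  have q1 : bigO0 1 (horner q).
    by apply: bigO0_dvdXn; rewrite -(expr1 q) dvdXn_exp.
  apply: eq_bigO0 (bigO0D (bigO0_leq (ltn0Sn n) gq) q1) => z.
  by rewrite subrK.
have pq : expands n.+1 (fun z => p.[g z]) (p \Po q).
  elim/poly_ind: p {fp} => [|p c IHp].
    rewrite comp_poly0; apply: eq_bigO0 (expands_horner n.+1 0) => z.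
    by rewrite !horner0.
  rewrite comp_poly_MXaddC; apply: eq_bigO0 (expandsM IHp gq) => z.
  by rewrite hornerMXaddC !hornerE; ring.
by apply: eq_bigO0 (bigO0D (bigO0_comp fp g1) pq) => z; rewrite addrA subrK.
Qed.

Lemma near_horner_neq0 q :
  q`_0 != 0 -> \forall z \near (0 : K^o), `|q`_0| / 2 <= `|q.[z]|.
Proof.
move=> q0; have d1 : bigO0 1 (fun z => q`_0 - q.[z]).
  have : 'X^1 %| (q`_0)%:P - q.
    by rewrite expr1 -['X]subr0 dvdp_XsubCl /root !hornerE horner_coef0 subrr.
  by move/bigO0_dvdXn; apply: eq_bigO0 => z; rewrite !hornerE.
have e0 : 0 < `|q`_0| / 2 by rewrite divr_gt0 // normr_gt0.
near=> z; have h : `|q`_0 - q.[z]| < `|q`_0| / 2 by near: z; exact: bigO0_small d1 e0.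
rewrite -(lerD2r (`|q`_0| / 2)) -splitr -[X in `|X| <= _](subrK q.[z]) addrC.
by rewrite (le_trans (ler_normD _ _)) // lerD2l ltW.
Unshelve. all: by end_near. Qed.

Lemma expands_divl n f p q :
  q`_0 != 0 -> expands n (fun z => q.[z] * f z) (q * p) -> expands n f p.
Proof.
move=> q0 [C C0 hC]; have e0 : 0 < `|q`_0| / 2 by rewrite divr_gt0 // normr_gt0.
exists (C / (`|q`_0| / 2)); first by rewrite divr_ge0 // ltW.
near=> z; have hq : `|q`_0| / 2 <= `|q.[z]| by near: z; exact: near_horner_neq0.
rewrite mulrAC ler_pdivlMr // mulrC.
apply: (@le_trans _ _ (`|q.[z]| * `|f z - p.[z]|)); first by rewrite ler_wpM2r.
by rewrite -normrM mulrBr -hornerM; near: z.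
Unshelve. all: by end_near. Qed.

(** Cauchy's estimate: convergence at one r > 0 bounds |a_k| r^k by some M, and for |z| <= r / 2 the
    terms from n on add up to at most 2 M (|z| / r)^n. *)
Lemma expands_series n (a : fps K) f :
  (\forall z \near (0 : K^o),
    series (fun k => a k * z ^+ k : K^o) @ \oo --> (f z : K^o))%classic ->
  expands n f (trunc n a).
Proof.
move=> hf; have [r [r0 hr]] : exists r : K, 0 < r /\
    (series (fun k => a k * r ^+ k : K^o) @ \oo --> (f r : K^o))%classic.
  by have /near0_ex_gt0[r r0 hr] := hf; exists r.
have [M M0 hM] : exists2 M : K, 0 <= M & forall k, `|a k| * r ^+ k <= M.
  have /cvgr_dist_lt/(_ _ ltr01)[N _ hN] := hr.
  (* From N on, a term is the difference of two partial sums within 1 of the limit, hence at most 2;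
     the earlier terms are bounded by their sum. *)
  exists (2 + \sum_(k < N) `|a k| * r ^+ k).
    by rewrite addr_ge0 // sumr_ge0 // => k _; rewrite mulr_ge0 // exprn_ge0 // ltW.
  have t0 k : 0 <= `|a k| * r ^+ k by rewrite mulr_ge0 // exprn_ge0 // ltW.
  move=> k; have [lt_kN|le_Nk] := ltnP k N.
    rewrite (bigD1 (Ordinal lt_kN)) //= addrCA lerDl addr_ge0 //.
    by rewrite sumr_ge0.
  rewrite ler_wpDr ?sumr_ge0 //.
  have h1 := hN k le_Nk; have h2 := hN k.+1 (leqW le_Nk).
  have -> : `|a k| * r ^+ k = `|(f r - series (fun k => a k * r ^+ k : K^o) k) -
     (f r - series (fun k => a k * r ^+ k : K^o) k.+1)|.
    rewrite /series /= big_nat_recr //= -[in LHS](gtr0_norm r0) -normrX -normrM.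
    by congr `|_|; ring.
  by rewrite (le_trans (ler_normB _ _)) // -[2]/(1 + 1) lerD ?ltW.
exists (M * 2 / r ^+ n); first by rewrite divr_ge0 ?mulr_ge0 ?exprn_ge0 // ltW.
near=> z; have z2 : `|z| / r <= 1 / 2.
  by rewrite ltW // ltr_pdivrMr //; near: z; apply: near0_lt; rewrite mulr_gt0 // divr_gt0.
have z0 : 0 <= `|z| / r by rewrite divr_ge0 // ltW.
have hz : (series (fun k => a k * z ^+ k : K^o) @ \oo --> (f z : K^o))%classic by near: z.
(* f z is known only as a limit: it is compared up to e with a partial sum of n + N terms. *)
apply/ler_addgt0Pr => e e0.
move/cvgr_dist_lt/(_ _ e0): hz => -[N _ hN].
have {hN} h1 := hN (n + N)%N (leq_addl _ _).
rewrite -(subrKA (series (fun k => a k * z ^+ k : K^o) (n + N)%N) (f z)).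
rewrite [leRHS]addrC (le_trans (ler_normD _ _)) // lerD ?(ltW h1) //.
rewrite horner_poly /series /= (big_cat_nat (n := n)) ?leq_addr //= big_mkord.
rewrite [X in `|X|]addrAC subrr add0r -{1}[n]add0n big_addn addKn big_mkord -[M * 2 / _ * _]mulrA.
have geo : \sum_(i < N) (`|z| / r) ^+ i <= 2.
  elim: (N) => [|k IHk]; first by rewrite big_ord0.
  rewrite big_ord_recl expr0 -[2]/(1 + 1) lerD2l.
  rewrite (eq_bigr (fun i : 'I_k => `|z| / r * (`|z| / r) ^+ i)); last first.
    by move=> i _; rewrite -exprS.
  rewrite -mulr_sumr (le_trans (ler_pM _ _ z2 IHk)) ?mul1r ?mulVf //.
  by rewrite sumr_ge0 // => i _; rewrite exprn_ge0.
have tn0 : 0 <= M * (`|z| / r) ^+ n by rewrite mulr_ge0 // exprn_ge0.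
rewrite (le_trans (ler_norm_sum _ _ _)) //.
rewrite [leRHS](_ : _ = M * (`|z| / r) ^+ n * 2); last first.
  by rewrite expr_div_n; ring.
apply: le_trans (ler_wpM2l tn0 geo); rewrite mulr_sumr ler_sum // => i _.
rewrite -mulrA -exprD addnC normrM normrX expr_div_n mulrA.
rewrite ler_pdivlMr ?exprn_gt0 // mulrAC ler_wpM2r ?exprn_ge0 //.
Unshelve. all: by end_near. Qed.

End Expansions.

(** * The complex exponential, logarithm and power *)

Section ExponentialSums.
Variable K : numFieldType.
Implicit Types (s t z : K) (u v w : K -> K) (k m n : nat).

Lemma bigO0_sum n m (F : 'I_m -> K -> K) :
  (forall i, bigO0 n (F i)) -> bigO0 n (fun z => \sum_i F i z).
Proof.
elim: m F => [|m IHm] F hF.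
  apply: eq_bigO0 (bigO0_dvdXn (dvdp0 ('X^n : {poly K}))) => z.
  by rewrite horner0 big_ord0.
apply: eq_bigO0 (bigO0D (IHm _ (fun i => hF (widen_ord (leqnSn m) i))) (hF ord_max)) => z.
by rewrite big_ord_recr.
Qed.

Lemma bigO0X n u :
  bigO0 1 u -> bigO0 n (fun z => u z ^+ n).
Proof.
move=> u1; elim: n => [|n IHn]; first exact: bigO0_cst.
by apply: eq_bigO0 (bigO0M u1 IHn) => z; rewrite exprS.
Qed.

(** This serves u = Re z and v = i Im z, which are not polynomials in z. T t is the truncated
    exponential of t X in an auxiliary X, evaluated at 1: below degree n, T s T t agrees with T (s +
    t) by the binomial formula, and its coefficient of degree n + k is homogeneous of that degree in
    s and t. *)
Lemma exp_trunc_add n u v :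
  bigO0 1 u -> bigO0 1 v ->
  bigO0 n (fun z => (trunc n (eseries K)).[u z] * (trunc n (eseries K)).[v z] -
    (trunc n (eseries K)).[u z + v z]).
Proof.
move=> u1 v1; pose T t : {poly K} := \poly_(i < n) (t ^+ i / i`!%:R).
have TE t : (trunc n (eseries K)).[t] = (T t).[1].
  by rewrite !horner_poly; apply: eq_bigr => i _; rewrite expr1n mulr1 mulrC.
have Tlow s t k : (k < n)%N -> (T s * T t)`_k = (s + t) ^+ k / k`!%:R.
  move=> lt_kn; rewrite coefM addrC exprDn mulr_suml; apply: eq_bigr => i _.
  have le_ik : (i <= k)%N by rewrite -ltnS.
  rewrite !coef_poly (leq_ltn_trans _ lt_kn) // (leq_ltn_trans _ lt_kn) ?leq_subr //.
  rewrite -mulr_natr -(bin_fact le_ik) !natrM mulrC.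
  have C0 : 'C(k, i)%:R != 0 :> K by rewrite pnatr_eq0 -lt0n bin_gt0.
  by field; rewrite C0 !fact_neq0.
have TT s t : (trunc n (eseries K)).[s] * (trunc n (eseries K)).[t] -
    (trunc n (eseries K)).[s + t] = \sum_(k < n) (T s * T t)`_(n + k).
  rewrite !TE -hornerM (@horner_coef_wide _ (n + n)); last first.
    rewrite (leq_trans (size_polyMleq _ _)) //.
    by rewrite (leq_trans (leq_pred _)) // leq_add // size_poly.
  rewrite big_split_ord /= horner_poly addrAC.
  rewrite (eq_bigr (fun k : 'I_n => (s + t) ^+ k / k`!%:R * 1 ^+ k)); last first.
    by move=> k _; rewrite Tlow.
  by rewrite subrr add0r; apply: eq_bigr => k _; rewrite expr1n mulr1.
apply: eq_bigO0 (fun z => esym (TT (u z) (v z))) _.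
apply: bigO0_sum => k; apply: (@bigO0_leq _ _ (n + k)); first exact: leq_addr.
have cO w (i : nat) : bigO0 1 w -> bigO0 i (fun z => (T (w z))`_i).
  move=> w1; have := bigO0M (bigO0X i w1)
    (bigO0_cst (if (i < n)%N then i`!%:R^-1 else 0)).
  by rewrite addn0; apply: eq_bigO0 => z; rewrite coef_poly; case: ifP; rewrite ?mulr0.
rewrite (_ : (fun z => (T (u z) * T (v z))`_(n + k)) = (fun z =>
   \sum_(i < (n + k).+1) (T (u z))`_i * (T (v z))`_(n + k - i))); last first.
  by apply/funext => z; rewrite coefM.
apply: bigO0_sum => i.
by have := bigO0M (cO u i u1) (cO v (n + k - i)%N v1); rewrite subnKC // -ltnS.
Qed.

End ExponentialSums.

Section ComplexExponential.
Variable R : realType.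
Local Notation C := R[i].
Implicit Types (z w : C) (m n k : nat) (f g u v : C -> C).
Local Open Scope complex_scope.

Lemma real_complexX (a : R) k : (a ^+ k)%:C = a%:C ^+ k.
Proof. exact: rmorphXn. Qed.

Lemma norm_real_complex (a : R) : `|a%:C| = `|a|%:C.
Proof. by rewrite normc_def /= expr0n addr0 sqrtr_sqr. Qed.

Lemma norm_Re z : `|(complex.Re z)%:C| <= `|z|.
Proof. by rewrite norm_real_complex normc_ge_Re. Qed.

Lemma norm_Im z : `|(complex.Im z)%:C| <= `|z|.
Proof.
rewrite norm_real_complex; case: z => a b; rewrite normc_def /= lecR.
by rewrite -sqrtr_sqr ler_wsqrtr // lerDr sqr_ge0.
Qed.

(** With h the real or the imaginary part, this carries real error bounds over to [R[i]]. *)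
Lemma bigO0_real (h : C -> R) n (f : R -> R) :
  (forall z, `|(h z)%:C| <= `|z|) -> bigO0 n f -> bigO0 n (fun z => (f (h z))%:C).
Proof.
move=> hz [D D0 /nbhs_ballP[e /= e0 he]]; exists D%:C; first by rewrite lecR.
near=> z; have hze : `|h z| < e.
  rewrite -ltcR -norm_real_complex; apply: le_lt_trans (hz z) _.
  by near: z; apply: near0_lt; rewrite ltcR.
have := he (h z); rewrite -ball_normE /= sub0r normrN => /(_ hze).
rewrite -lecR -norm_real_complex => /le_trans; apply.
rewrite rmorphM /= real_complexX ler_wpM2l ?lecR // lerXn2r ?nnegrE //.
  by rewrite lecR.
by rewrite -norm_real_complex.
Unshelve. all: by end_near. Qed.

End ComplexExponential.

Section ComplexPower.
Variable R : realType.
Local Notation C := R[i].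
Implicit Types (a b t : R) (z w : C) (m n k : nat).
Local Open Scope complex_scope.

Definition cos_series : fps R :=
  fun k => (~~ odd k)%:R * (-1) ^+ k./2 / k`!%:R.
Definition sin_series : fps R :=
  fun k => (odd k)%:R * (-1) ^+ k.-1./2 / k`!%:R.

Lemma expands_expR n : expands n expR (trunc n (eseries R)).
Proof.
apply: expands_series; near=> t.
rewrite (_ : (fun k => _) = exp_coeff t); first exact: is_cvg_series_exp_coeff.
by rewrite exp_coeffE.
Unshelve. all: by end_near. Qed.

Lemma expands_cos n : expands n cos (trunc n cos_series).
Proof.
apply: expands_series; near=> t.
rewrite (_ : (fun k => _) = cos_coeff t); last first.
  by apply/funext => k; rewrite /cos_series /cos_coeff /= mulrAC.
by rewrite unlock; exact: is_cvg_series_cos_coeff.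
Unshelve. all: by end_near. Qed.

Lemma expands_sin n : expands n sin (trunc n sin_series).
Proof.
apply: expands_series; near=> t.
rewrite (_ : (fun k => _) = sin_coeff t); last first.
  by apply/funext => k; rewrite /sin_series /sin_coeff /= mulrAC.
by rewrite unlock; exact: is_cvg_series_sin_coeff.
Unshelve. all: by end_near. Qed.

Lemma expr_im k :
  'i%C ^+ k = ((~~ odd k)%:R * (-1) ^+ k./2)%:C + 'i%C * ((odd k)%:R * (-1) ^+ k.-1./2)%:C :> C.
Proof.
have i2 m : 'i%C ^+ m.*2 = ((-1) ^+ m)%:C :> C.
  by rewrite -mul2n exprM sqr_i real_complexX rmorphN rmorph1.
rewrite -{1}[k]odd_double_half exprD i2; case: (boolP (odd k)) => ok /=.
  have -> : (k.-1./2 = k./2)%N by rewrite -{1}[k]odd_double_half ok /= doubleK.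
  by rewrite expr1 !mul0r !mul1r add0r.
by rewrite expr0 !mul0r !mul1r mulr0 addr0.
Qed.

Lemma cexpE z : cexp z = (expR (complex.Re z))%:C *
  ((cos (complex.Im z))%:C + 'i%C * (sin (complex.Im z))%:C).
Proof. by apply/eqP; rewrite eq_complex /= !(mul0r, mul1r, add0r, addr0, subr0, mulr0) !eqxx. Qed.

Lemma cexpD z w : cexp (z + w) = cexp z * cexp w.
Proof.
case: z w => [a b] [a' b']; rewrite /cexp /= expRD cosD sinD.
by apply/eqP; rewrite eq_complex /=; apply/andP; split; apply/eqP; ring.
Qed.

Lemma expands_cexp n : expands n (@cexp R) (trunc n (eseries C)).
Proof.
set E := trunc n (eseries C).
pose u z : C := (complex.Re z)%:C; pose v z : C := 'i%C * (complex.Im z)%:C.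
have u1 : bigO0 1 u.
  by exists 1 => //; near=> z; rewrite mul1r expr1 norm_Re.
have ni : `|'i%C| = 1 :> C by rewrite normc_def /= expr0n add0r expr1n sqrtr1.
have v1 : bigO0 1 v.
  by exists 1 => //; near=> z; rewrite mul1r expr1 normrM ni mul1r norm_Im.
have eO : bigO0 n (fun z => (expR (complex.Re z))%:C - E.[u z]).
  apply: eq_bigO0 (bigO0_real (@norm_Re R) (expands_expR n)) => z.
  rewrite rmorphB /= !horner_poly; congr (_ - _); rewrite rmorph_sum /=.
  by apply: eq_bigr => k _; rewrite rmorphM /= real_complexX fmorphV rmorph_nat.
have iO : bigO0 0 (fun=> 'i%C : C) by exact: bigO0_cst.
have cO : bigO0 n (fun z => (cos (complex.Im z))%:C + 'i%C * (sin (complex.Im z))%:C - E.[v z]).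
  have h := bigO0D (bigO0_real (@norm_Im R) (expands_cos n))
    (bigO0M iO (bigO0_real (@norm_Im R) (expands_sin n))).
  apply: eq_bigO0 h => z; rewrite !rmorphB /= mulrBr addrACA -opprD; congr (_ - _).
  rewrite !horner_poly !rmorph_sum /= mulr_sumr -big_split; apply: eq_bigr => k _ /=.
  rewrite /v exprMn expr_im -real_complexX /cos_series /sin_series /eseries.
  rewrite !(rmorphM, fmorphV, rmorph_nat) /=.
  by ring.
have uv : bigO0 n _ := exp_trunc_add n u1 v1.
have Eu0 : bigO0 0 (fun z => E.[u z]) by exact: bigO0_comp (bigO0_horner E) u1.
have Ev0 : bigO0 0 (fun z => E.[v z]) by exact: bigO0_comp (bigO0_horner E) v1.
have c0 := bigO0D (bigO0_leq (leq0n n) cO) Ev0.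
have ec := bigO0M eO c0; rewrite addn0 in ec.
(* With c = cos (Im z) + i sin (Im z), the error is (exp(u) - E(u)) c + E(u) (c - E(v)) + (E(u) E(v)
   - E(u + v)). *)
apply: eq_bigO0 (bigO0D (bigO0D ec (bigO0M Eu0 cO)) uv) => z.
have zE : z = u z + v z by rewrite /u /v -complexE.
rewrite cexpE [in X in _ = _ - X]zE -/E.
by ring.
Unshelve. all: by end_near. Qed.

End ComplexPower.

(** * The principal logarithm and its continuity at 1 *)

Section ComplexLogarithm.
Variable R : realType.
Local Notation C := R[i].
Implicit Types (a b e : R) (z w : C) (n : nat).
Local Open Scope complex_scope.

Lemma normc_gt0 w : w != 0 -> 0 < Normc.normc w.
Proof.
move=> w0; rewrite lt_def; apply/andP; split; last by case: w {w0} => a b; exact: sqrtr_ge0.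
by apply: contra w0 => /eqP/Normc.eq0_normc ->.
Qed.

Lemma normc_sqr w : Normc.normc w ^+ 2 = complex.Re w ^+ 2 + complex.Im w ^+ 2.
Proof. by case: w => a b; rewrite sqr_sqrtr // addr_ge0 ?sqr_ge0. Qed.

Lemma Re_div_normc w : w != 0 -> -1 <= complex.Re w / Normc.normc w <= 1.
Proof.
move=> /normc_gt0 r0; rewrite -ler_norml normrM normfV (gtr0_norm r0) ler_pdivrMr // mul1r.
rewrite -(ler_pXn2r (n := 2)) ?nnegrE ?(ltW r0) // normc_sqr real_normK ?num_real //.
by rewrite lerDl sqr_ge0.
Qed.

(** [acos] fixes the cosine of the argument and its sine up to sign; the test on the imaginary part
    in [cArg] sets that sign. *)
Lemma cexp_cLog w : w != 0 -> cexp (cLog w) = w.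
Proof.
move=> w0; have r0 := normc_gt0 w0; have t1 := Re_div_normc w0.
rewrite /cexp /cLog /= lnK ?posrE //.
set r := Normc.normc w in r0 t1 *; set t := _ / r in t1 *.
have cosE : cos (cArg w) = t.
  by rewrite /cArg -/r -/t; case: ifP => _; rewrite ?cosN acosK // in_itv.
have sE : sin (acos t) = `|complex.Im w| / r.
  rewrite sin_acos // -sqrtr_sqr -[r in RHS](gtr0_norm r0) -(sqrtr_sqr r) -sqrtrV ?sqr_ge0 //.
  rewrite -sqrtrM ?sqr_ge0 //; congr Num.sqrt.
  rewrite /t expr_div_n.
  have r2 : r ^+ 2 != 0 by rewrite expf_neq0 // gt_eqF.
  have -> : complex.Im w ^+ 2 = r ^+ 2 - complex.Re w ^+ 2 by rewrite [r ^+ 2]normc_sqr addrC addKr.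
  by rewrite mulrBl mulfV.
have sinE : sin (cArg w) = complex.Im w / r.
  rewrite /cArg -/r -/t; case: ifP => [im0|/negbT].
    by rewrite sE ger0_norm.
  by rewrite -ltNge => im0; rewrite sinN sE ltr0_norm // mulNr opprK.
rewrite cosE sinE /t ![r * _]mulrC !divfK ?gt_eqF //.
by case: (w).
Qed.

Lemma normc_le_Re_Im w : Normc.normc w <= `|complex.Re w| + `|complex.Im w|.
Proof.
rewrite -(ler_pXn2r (n := 2)) ?nnegrE ?addr_ge0 //; last first.
  by case: w => a b; exact: sqrtr_ge0.
rewrite normc_sqr sqrrD !real_normK ?num_real // addrAC lerDl.
by rewrite mulrn_wge0 // mulr_ge0.
Qed.

(** [cos] decreases strictly on [0, pi], and e <= 1 lies there because pi >= 2. *)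
Lemma acos_lt (e t : R) : 0 < e <= 1 -> -1 <= t <= 1 -> cos e < t -> acos t < e.
Proof.
move=> /andP[e0 e1] t1; apply: contraTT; rewrite -!leNgt => le_e.
have epi : e \in `[0, pi].
  by rewrite in_itv /= ltW //= (le_trans e1) // (le_trans _ (pi_ge2 R)) // ler1n.
have api : acos t \in `[0, pi] by rewrite in_itv /= acos_ge0 // acos_lepi.
rewrite -[leLHS](_ : cos (acos t) = _); last by rewrite acosK // in_itv.
rewrite leNgt; apply/negP; rewrite ltr_cos //.
by rewrite ltNge le_e.
Qed.

Lemma cLog_small (e : R) : 0 < e -> exists2 d : R, 0 < d &
  forall w, `|w - 1| < d%:C -> w != 0 /\ `|cLog w| < e%:C.
Proof.
move=> e0; pose e1 := Num.min (e / 2) 1.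
have e1_gt0 : 0 < e1 by rewrite lt_min ltr01 divr_gt0.
have e1_le1 : e1 <= 1 by rewrite ge_min lexx orbT.
have e1_le : e1 <= e / 2 by rewrite ge_min lexx.
have c1 : cos e1 < 1.
  rewrite -[ltRHS]cos0 ltr_cos ?in_itv /= ?lexx ?pi_ge0 //.
  by rewrite ltW //= (le_trans e1_le1) // (le_trans _ (pi_ge2 R)) // ler1n.
have : \forall r \near (1 : R), `|ln 1 - ln r| < e / 2.
  by move/cvgr_dist_lt: (continuous_ln (@ltr01 R)); apply; rewrite divr_gt0.
move=> /nbhs_ballP[d0 /= d00 hd0].
(* [d0] controls the logarithm of the modulus. Since Re w > 1 - d and the modulus of w is within d
   of 1, the second bound gives cos e1 < Re w / |w|. The last one keeps w away from 0. *)
pose d := Num.min (Num.min d0 ((1 - cos e1) / 2)) (1 / 2).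
have d_gt0 : 0 < d by rewrite !lt_min d00 !divr_gt0 // subr_gt0.
exists d => // w; rewrite normc_def ltcR => hw.
have nw : Normc.normc (w - 1) < d.
  by move: hw; case: (w).
have dd0 : d <= d0 by rewrite /d !ge_min lexx.
have dd1 : d <= (1 - cos e1) / 2 by rewrite /d !ge_min lexx orbT.
have dd2 : d <= 1 / 2 by rewrite /d !ge_min lexx !orbT.
have hRe : `|complex.Re w - 1| < d.
  apply: le_lt_trans nw; have := normc_ge_Re (w - 1); rewrite normc_def lecR.
  by case: (w).
have hr : `|1 - Normc.normc w| < d.
  apply: le_lt_trans nw; rewrite distrC.
  have h1 := le_normcD (w - 1) 1; have h2 := le_normcD (1 - w) w.
  rewrite subrK Normc.normc1 in h1; rewrite subrK Normc.normc1 -opprB normcN in h2.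
  by rewrite ler_norml; apply/andP; split; lra.
have r0 : 0 < Normc.normc w by move: hr; rewrite ltr_norml; lra.
have w0 : w != 0 by apply: contraTneq r0 => ->; rewrite Normc.normc0 ltxx.
split => //.
have hln : `|ln (Normc.normc w)| < e / 2.
  rewrite -normrN -sub0r -ln1; apply: hd0.
  by rewrite -ball_normE /=; apply: lt_le_trans dd0.
have harg : `|cArg w| < e / 2.
  have t1 := Re_div_normc w0; apply: lt_le_trans e1_le.
  have ac : acos (complex.Re w / Normc.normc w) < e1.
    apply: acos_lt => //; first by rewrite e1_gt0.
    rewrite ltr_pdivlMr //.
    have hc : -1 <= cos e1 := cos_geN1 e1.
    move: hRe hr; rewrite !ltr_norml => /andP[h1 h2] /andP[h3 h4].
    by nra.
  by rewrite /cArg; case: ifP => _; rewrite ?normrN ger0_norm // acos_ge0.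
rewrite normc_def ltcR; apply: le_lt_trans (normc_le_Re_Im (cLog w)) _.
by rewrite [ltRHS]splitr ltrD.
Qed.

End ComplexLogarithm.

(** * The expansion of Xi at 0 *)

Section XiExpansion.
Variable R : realType.
Local Notation C := R[i].
Variable x : C.
Implicit Types (nu z w : C) (n : nat).

Let wq z : C := (1 - z) / (1 - z * (1 - x)).

Lemma ode_sol_1subX n : ode_sol x n (-1) 0 (1 - 'X).
Proof.
split; first by rewrite -horner_coef0 !hornerE subr0.
rewrite derivB derivX -polyC1 derivC polyC1 /ode_rhs /ode_lead mul0r.
by rewrite /eqX (_ : _ - _ = 0) ?dvdp0 //; ring.
Qed.

Lemma ode_sol_1subyX n : ode_sol x n (-1) (-1) (1 - (1 - x)%:P * 'X).
Proof.
split; first by rewrite -horner_coef0 !hornerE ?mulr0 subr0.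
rewrite derivB deriv_mulC derivX -polyC1 derivC polyC1 /ode_rhs /ode_lead.
by rewrite /eqX (_ : _ - _ = 0) ?dvdp0 //; ring.
Qed.

Lemma hseries_1subX n nu :
  eqX n.+1 ((1 - 'X) * trunc n.+1 (hseries x 1 nu)) (trunc n.+1 (hseries x 0 nu)).
Proof.
have := ode_sol_uniq (ode_solM (ode_sol_1subX n) (hseries_ode x n 1 nu)).
by rewrite addrC subrr add0r; apply; exact: hseries_ode.
Qed.

Lemma hseries_1subyX n :
  eqX n.+1 ((1 - (1 - x)%:P * 'X) * trunc n.+1 (hseries x 0 1)) (1 - 'X).
Proof.
have := ode_sol_uniq (ode_solM (ode_sol_1subyX n) (hseries_ode x n 0 1)).
by rewrite addr0 addrC subrr; apply; exact: ode_sol_1subX.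
Qed.

Lemma wq_den_neq0 : \forall z \near (0 : C^o), 1 - z * (1 - x) != 0.
Proof.
have := @near_horner_neq0 _ (1 - (1 - x)%:P * 'X).
have -> : (1 - (1 - x)%:P * 'X)`_0 = 1 by rewrite -horner_coef0 !hornerE ?mulr0 subr0.
move=> /(_ (oner_neq0 _)) h; near=> z.
have : `|1| / 2 <= `|(1 - (1 - x)%:P * 'X).[z]| by near: z.
rewrite !hornerE [(1 - x) * z]mulrC; apply: contraTneq => ->.
by rewrite normr0 normr1 lt_geF ?divr_gt0.
Unshelve. all: by end_near. Qed.

Lemma expands_wq n : expands n.+1 wq (trunc n.+1 (hseries x 0 1)).
Proof.
apply: (@expands_divl _ _ _ _ (1 - (1 - x)%:P * 'X)).
  by rewrite -horner_coef0 !hornerE ?mulr0 subr0 oner_eq0.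
apply: expands_eqX (eqX_sym (hseries_1subyX n)).
apply: expands_near (expands_horner _ _).
near=> z; have z0 : 1 - z * (1 - x) != 0 by near: z; exact: wq_den_neq0.
rewrite !hornerE [(1 - x) * z]mulrC /wq [RHS]mulrC; apply/esym/mulKf.
Unshelve. all: by end_near. Qed.

(** Quantitative injectivity of the exponential at 0: by the expansion to order 2, |cexp z - 1 - z|
    <= |z| / 2 for small z. *)
Lemma cexp_sub_small : \forall z \near (0 : C^o), `|z| <= 2 * `|cexp z - 1|.
Proof.
have [D D0 hD] := expands_cexp R 2.
have D1 : 0 < D + 1 by rewrite ltr_wpDl.
near=> z; have : `|z| < 1 / 2 / (D + 1).
  by near: z; apply: near0_lt; rewrite !divr_gt0.
rewrite ltr_pdivlMr // => zs.
have Dz : D * `|z| <= 1 / 2.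
  by apply: le_trans (ltW zs); rewrite mulrC ler_wpM2l // lerDl.
have : `|cexp z - (trunc 2 (eseries C)).[z]| <= D * `|z| ^+ 2 by near: z.
have -> : (trunc 2 (eseries C)).[z] = 1 + z.
  rewrite horner_poly !big_ord_recl big_ord0 /eseries /= expr0 expr1 !invr1.
  by ring.
move=> h; have : `|z| <= `|cexp z - 1| + 1 / 2 * `|z|.
  rewrite -[X in `|X| <= _](_ : (cexp z - 1) - (cexp z - (1 + z)) = z); last by ring.
  rewrite (le_trans (ler_normB _ _)) // lerD2l (le_trans h) //.
  by rewrite expr2 mulrA ler_wpM2r.
rewrite -lerBlDr (_ : `|z| - 1 / 2 * `|z| = `|z| / 2); last by field.
by rewrite ler_pdivrMr // mulrC.
Unshelve. all: by end_near. Qed.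

Lemma expands_cLog_wq n : expands n.+1 (fun z => cLog (wq z)) (trunc n.+1 (lseries x)).
Proof.
set L := trunc _ _; have L0 : L`_0 = 0 by rewrite coef_trunc // /lseries invr0 mulr0.
(* exp(-L) expands as H_{0,-1}, the inverse of the expansion H_{0,1} of [wq]. *)
have ex : expands n.+1 (fun z => wq z * cexp ((-1)%:P * L).[z]) 1.
  have NL0 : ((-1)%:P * L)`_0 = 0 by rewrite coefCM L0 mulr0.
  have h := expands_comp NL0 (expands_cexp R n.+1) (expands_horner n.+1 _).
  apply: expands_eqX (expandsM (expands_wq n) (expands_eqX h (exp_lseries x n (-1)))) _.
  apply: eqX_trans (hseriesM x _ _ _ _ _) _; rewrite addr0 subrr.
  exact: ode_sol_uniq (hseries_ode x n 0 0) (ode_sol1 x n).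
pose dl z := cLog (wq z) - L.[z].
have w1 : \forall z \near (0 : C^o), wq z != 0 -> wq z * cexp ((-1)%:P * L).[z] = cexp (dl z).
  near=> z => w0; rewrite /dl cexpD cexp_cLog //; congr (_ * cexp _).
  by rewrite !hornerE mulN1r.
have wO : bigO0 1 (fun z => wq z - 1).
  have := expands_wq 0; apply: eq_bigO0 => z; congr (_ - _).
  by rewrite horner_poly big_ord1 hseries0 mul1r expr0.
(* The principal branch matters here: that [cexp (dl z)] is close to 1 would by itself allow [dl z]
   to be near any multiple of 2 i pi. *)
have small (e : R) : 0 < e -> \forall z \near (0 : C^o), wq z != 0 /\ `|cLog (wq z)| < (e%:C)%C.
  move=> e0; have [d d0 hd] := cLog_small e0.
  by near=> z; apply: hd; near: z; apply: bigO0_small wO _; rewrite ltcR.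
have LO : bigO0 1 (horner L) by apply: bigO0_dvdXn; rewrite -(expr1 L) dvdXn_exp.
have [D D0 hD] : bigO0 n.+1 (fun z => cexp (dl z) - 1).
  have : bigO0 n.+1 (fun z => wq z * cexp ((-1)%:P * L).[z] - 1).
    by apply: eq_bigO0 ex => z; rewrite hornerC.
  apply: bigO0_near; near=> z; congr (_ - _).
  have [w0 _] : wq z != 0 /\ `|cLog (wq z)| < (1%:C)%C by near: z; exact: small.
  by have := w0; near: z.
have /nbhs_ballP[e /= e0 he] := cexp_sub_small.
(* The radius e is a positive element of [R[i]], hence real, whereas [small] takes a bound in
   [R]. *)
have eR : e = (complex.Re e)%:C%C by apply/esym/RRe_real/gtr0_real.
have eR0 : 0 < complex.Re e / 2 by rewrite divr_gt0 // -ltcR -eR.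
exists (2 * D); first by rewrite mulr_ge0.
near=> z; apply: (@le_trans _ _ (2 * `|cexp (dl z) - 1|)); last first.
  by rewrite -mulrA ler_wpM2l //; near: z.
apply: he; rewrite -ball_normE /= sub0r normrN eR.
have h1 : wq z != 0 /\ `|cLog (wq z)| < ((complex.Re e / 2)%:C)%C by near: z; exact: small.
have h2 : `|L.[z]| < ((complex.Re e / 2)%:C)%C.
  by near: z; apply: bigO0_small LO _; rewrite ltcR.
rewrite [complex.Re e]splitr rmorphD /= (le_lt_trans (ler_normB _ _)) // ltrD //.
by case: h1.
Unshelve. all: by end_near. Qed.

(** After multiplication by z - 1, Xi becomes z w^nu, and w^nu = cexp (nu cLog w) expands as exp(nu
    L) = H_{0,nu} = (1 - z) H_{1,nu}. *)
Lemma expands_Xi nu n :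
  expands n.+1 (Xi x nu) (- 'X * trunc n.+1 (hseries x 1 nu)).
Proof.
apply: (@expands_divl _ _ _ _ ('X - 1)).
  by rewrite -horner_coef0 !hornerE ?sub0r oppr_eq0 oner_eq0.
set L := trunc n.+1 (lseries x).
have L0 : (nu%:P * L)`_0 = 0 by rewrite coefCM coef_trunc // /lseries invr0 !mulr0.
have nL : expands n.+1 (fun z => nu * cLog (wq z)) (nu%:P * L).
  apply: eq_bigO0 (expandsM (expands_horner n.+1 nu%:P) (expands_cLog_wq n)) => z.
  by rewrite hornerC.
have hp := expands_eqX (expands_comp L0 (expands_cexp R n.+1) nL) (exp_lseries x n nu).
have hX := expands_eqX (expandsM (expands_horner n.+1 'X) hp)
  (eqXM (eqX_refl _ 'X) (eqX_sym (hseries_1subX n nu))).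
rewrite (_ : _ * (- 'X * _) = 'X * ((1 - 'X) * trunc n.+1 (hseries x 1 nu))); last by ring.
apply: expands_near hX; near=> z.
have z1 : z != 1.
  by have : `|z| < 1 by [near: z; exact: near0_lt]; apply: contraTneq => ->; rewrite normr1 ltxx.
have -> : ('X - 1 : {poly C}).[z] = z - 1 by rewrite !hornerE.
by rewrite hornerX /Xi /cpow mulrA [(z - 1) * _]mulrC divfK // subr_eq0.
Unshelve. all: by end_near. Qed.

End XiExpansion.

(** [inverse_near0] speaks of z and w that are both near 0; g = O(w) makes z = g w admissible. *)
Lemma inverse_near0_comp (R : realType) (f g : R[i] -> R[i]) :
  bigO0 1 g -> inverse_near0 f g ->
  \forall w \near (0 : R[i]^o), w = f (g w).
Proof.
move=> g1 [[/= U V] /= [/nbhs_ballP[e /= e0 he] V0] hUV]; near=> w.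
have /= fgw := hUV (g w, w).
apply/esym; apply/fgw => //; split; last by near: w.
apply: he; rewrite -ball_normE /= sub0r normrN.
by near: w; apply: bigO0_small g1 e0.
Unshelve. all: by end_near. Qed.

Theorem corollary3p1 (R : realType) (x nu : R[i]) (S T : nat -> R[i])
    (hST : (forall n, (0 < n)%N -> S n = mat_apply (matB x nu) T n) \/
           (forall n, (0 < n)%N -> T n = mat_apply (matA x nu) S n))
    (Xi_s : fps R[i]) (hXi : power_series_at0 Xi_s (Xi x nu)) :
  (gen_series S =1
     prefactor x nu (fpsX R[i]) * (gen_series T \o Xi_s))%fps /\
  (forall Omega : R[i] -> R[i],
     Omega 0 = 0 -> inverse_near0 (Xi x nu) Omega ->
   forall Omega_s : fps R[i], power_series_at0 Omega_s Omega ->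
   (gen_series T =1
      (gen_series S \o Omega_s) * (prefactor x nu Omega_s)^-1)%fps).
Proof.
have {hST} ST : forall n, (0 < n)%N -> S n = mat_apply (matB x nu) T n.
  by case: hST => // /mat_apply_inv.
(* [Xi_s] is given only through its convergence to [Xi]; uniqueness of expansions identifies it. *)
have eXi n : eqX n (trunc n Xi_s) (- 'X * trunc n (hseries x 1 nu)).
  case: n => [|n]; first by rewrite /eqX expr0 dvd1p.
  exact: expands_uniq (expands_series _ hXi) (expands_Xi x nu n).
have Xi0 : Xi_s 0%N = 0.
  have /eqXP/(_ 0%N isT) := eXi 1%N.
  by rewrite coef_trunc // mulNr coefN coefXM oppr0.
have GS n := gen_series_B ST (eXi n).
split=> [|Omega Om0 hOm Om_s hOm_s].
  apply: eqfps_trunc => n; apply: eqX_trans (GS n) _; apply: eqX_sym.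
  apply: eqX_trans (truncM _ _ _) _; apply: eqXM; first exact: eqX_refl.
  exact: trunc_comp.
have eOm n : expands n Omega (trunc n Om_s) := expands_series n hOm_s.
have Om_s0 : Om_s 0%N = 0.
  have := bigO0_at0 (eOm 1%N); rewrite Om0 horner_coef0 coef_trunc // sub0r.
  by move/eqP; rewrite oppr_eq0 => /eqP.
have Om1 : bigO0 1 Omega.
  apply: eq_bigO0 (eOm 1%N) => z.
  by rewrite horner_poly big_ord1 Om_s0 mul0r subr0.
have XiOm := inverse_near0_comp Om1 hOm.
(* Both sides are expansions of [Xi] composed with [Omega], which is the identity near 0. *)
have XiOms n : eqX n (trunc n Xi_s \Po trunc n Om_s) 'X.
  case: n => [|n]; first by rewrite /eqX expr0 dvd1p.
  have Om0' : (trunc n.+1 Om_s)`_0 = 0 by rewrite coef0_trunc.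
  have h := expands_comp Om0' (expands_series n.+1 hXi) (eOm n.+1).
  apply: expands_uniq h _; apply: expands_near XiOm _.
  by apply: eq_bigO0 (expands_horner n.+1 'X) => z; rewrite hornerX.
apply: eqfps_trunc => n.
exact: gen_series_inv Xi0 Om_s0 (XiOms n) (GS n).
Qed.
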